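(* Let $C\subset\mathbb{R}^2$ be an oval. The affine reflection map $\Phi_C:\mathcal S_C\to\mathcal S_C$ is a smooth involutive diffeomorphism. Its fixed-point set is $$\mathcal F_C=\{\overline{x\,\iota_C(x)}:x\in C\},$$ the curve of affine chords. Moreover, for every invertible affine map $A:\mathbb{R}^2\to\mathbb{R}^2$ and every $\ell\in\mathcal S_C$, $$\Phi_{A(C)}(A\ell)=A\bigl(\Phi_C(\ell)\bigr).$$
   Context: An oval is a smooth ($C^\infty$), strictly convex simple closed curve $C\subset\mathbb{R}^2$ with positive curvature. For $x\in C$, $\iota_C(x)\in C$ denotes the unique point of $C$ different from $x$ whose tangent line is parallel to $T_xC$; $\iota_C:C\to C$ is a smooth fixed-point-free involution. For distinct points $x,y$, $\overline{xy}$ is the line through $x$ and $y$. Let $\mathcal L=(\mathbb{RP}^2)^*$ be the real projective plane of lines $ax+by+c=0$, with homogeneous coordinates $[a:b:c]$. Let $\mathcal S_C\subset\mathcal L$ be the open set (an open Möbius band) of lines meeting $C$ in exactly two distinct points (secant lines), with the smooth structure induced from $\mathcal L$. The affine reflection map sends the secant line $\overline{xy}$ ($x,y\in C$, $x\ne y$) to $\Phi_C(\overline{xy})=\overline{\iota_C(x)\,\iota_C(y)}$. *)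

(* Defs.v *)
From HB Require Import structures.
From mathcomp Require Import all_boot all_order all_algebra.
From mathcomp Require Import all_classical all_reals all_analysis.
From mathcomp Require Import ring lra.
Set Implicit Arguments.
Unset Strict Implicit.
Unset Printing Implicit Defensive.
Import Order.TTheory GRing.Theory Num.Theory.
Import numFieldNormedType.Exports.

Local Open Scope ring_scope.
Local Open Scope classical_set_scope.
Local Open Scope quotient_scope.

(* [Ck n U f]: [f] is n times continuously differentiable on the open set [U].
   In finite dimension this agrees with the definition by iterated partial
   derivatives. *)
Fixpoint Ck (R : realType) (V W : normedModType R) (n : nat) (U : set V)
    (f : V -> W) : Prop :=
  match n with
  | 0 => forall x, U x -> {for x, continuous f}
  | m.+1 => (forall x, U x -> differentiable f x) /\
            (forall v : V, Ck m U (fun x => 'D_v f x))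
  end.

Definition smooth_on (R : realType) (V W : normedModType R) (U : set V)
  (f : V -> W) : Prop := forall n, Ck n U f.

(* The projective plane of lines: nonzero coordinate vectors (a, b, c) up to
   scaling, with the quotient topology. *)
Record nzvec (R : realType) := NzVec {
  nzval :> 'rV[R]_3;
  nzval_neq0 : nzval != 0
}.
HB.instance Definition _ (R : realType) := [isSub for @nzval R].
HB.instance Definition _ (R : realType) := [Choice of nzvec R by <:].
HB.instance Definition _ (R : realType) :=
  Topological.copy (nzvec R) (initial_topology (@nzval R)).

Definition proportional (R : realType) (u v : nzvec R) : bool :=
  `[< exists2 k : R, k != 0 & nzval u = k *: nzval v >].

Lemma proportional_refl (R : realType) : reflexive (@proportional R).
Proof. by move=> u; apply/asboolP; exists 1; rewrite ?oner_neq0 ?scale1r. Qed.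

Lemma proportional_sym (R : realType) : symmetric (@proportional R).
Proof.
have sub (u v : nzvec R) : proportional u v -> proportional v u.
  move=> /asboolP[k k0 uv]; apply/asboolP; exists k^-1; first by rewrite invr_eq0.
  by rewrite uv scalerA mulVf // scale1r.
by move=> u v; apply/idP/idP; exact: sub.
Qed.

Lemma proportional_trans (R : realType) : transitive (@proportional R).
Proof.
move=> v u w /asboolP[k k0 uv] /asboolP[h h0 vw]; apply/asboolP.
by exists (k * h); rewrite ?mulf_neq0 // uv vw scalerA.
Qed.

Canonical proportional_equiv (R : realType) :=
  EquivRel (@proportional R) (@proportional_refl R) (@proportional_sym R)
    (@proportional_trans R).

Definition line (R : realType) := {eq_quot (@proportional_equiv R)}.
HB.instance Definition _ (R : realType) :=
  Topological.copy (line R) (quotient_topology (line R)).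
HB.instance Definition _ (R : realType) := EqQuotient.on (line R).

(* Some homogeneous coordinate vector [a : b : c] of [l]. *)
Definition coords (R : realType) (l : line R) : 'rV[R]_3 := nzval (repr l).

Lemma infinity_neq0 (R : realType) : delta_mx 0 ord_max != 0 :> 'rV[R]_3.
Proof.
by apply/eqP => /rowP /(_ ord_max) /eqP; rewrite !mxE !eqxx /= oner_eq0.
Qed.

(* The line with homogeneous coordinates [v]; junk value (the line at
   infinity) when [v = 0]. *)
Definition mkline (R : realType) (v : 'rV[R]_3) : line R :=
  \pi_(line R) (insubd (NzVec (infinity_neq0 R)) v).

Definition points (R : realType) (l : line R) : set 'rV[R]_2 :=
  [set p | coords l 0 0 * p 0 0 + coords l 0 1 * p 0 1 + coords l 0 ord_max = 0].

(* The line through [x] and [y]: the cross product of (x, 1) and (y, 1);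
   junk when [x = y]. *)
Definition join (R : realType) (x y : 'rV[R]_2) : line R :=
  mkline (\row_(k < 3) [:: x 0 1 - y 0 1; y 0 0 - x 0 0;
                           x 0 0 * y 0 1 - x 0 1 * y 0 0]`_k).

(* The three standard affine charts: [chart i] divides by the coordinate [i],
   on the open set [chart_dom i] where it does not vanish. *)
Definition chart_dom (R : realType) (i : 'I_3) : set (line R) :=
  [set l | coords l 0 i != 0].

Definition chart (R : realType) (i : 'I_3) (l : line R) : 'rV[R]_2 :=
  \row_(j < 2) (coords l 0 (lift i j) / coords l 0 i).

Definition unchart (R : realType) (i : 'I_3) (u : 'rV[R]_2) : line R :=
  mkline (\row_(k < 3) if unlift i k is Some j then u 0 j else 1).

(* Smoothness on an open set [U] of lines: [f] is continuous on [U] and all its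
   expressions in the standard charts are smooth. *)
Definition smooth_lines (R : realType) (U : set (line R))
    (f : line R -> line R) : Prop :=
  {within U, continuous f} /\
  forall i j : 'I_3,
    smooth_on [set u | U (unchart i u) /\ chart_dom j (f (unchart i u))]
      (fun u => chart j (f (unchart i u))).

Definition diffeomorphism (R : realType) (U V : set (line R))
    (f : line R -> line R) : Prop :=
  exists g : line R -> line R,
    [/\ set_fun U V f, set_fun V U g, {in U, cancel f g}, {in V, cancel g f}
      & smooth_lines U f /\ smooth_lines V g].

Definition det2 (R : realType) (u v : 'rV[R]_2) : R :=
  u 0 0 * v 0 1 - u 0 1 * v 0 0.

Definition curvature (R : realType) (g : R -> 'rV[R]_2) (t : R) : R :=
  det2 (derive1 g t) (derive1n 2 g t) /
  Num.sqrt ((derive1 g t) 0 0 ^+ 2 + (derive1 g t) 0 1 ^+ 2) ^+ 3.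

(* [g] is a smooth regular 1-periodic parametrization of the simple closed
   curve [C]. *)
Definition closed_param (R : realType) (g : R -> 'rV[R]_2)
    (C : set 'rV[R]_2) : Prop :=
  [/\ forall n t, derivable (derive1n n g) t 1,
      forall t, derive1 g t != 0,
      forall t, g (t + 1) = g t,
      {in `[0, 1[ &, injective g}
    & range g = C].

(* Each tangent line meets the curve only at its point of tangency, the rest of
   the curve lying in one of the two open half-planes. *)
Definition strictly_convex (R : realType) (g : R -> 'rV[R]_2) : Prop :=
  forall t, (forall s, g s != g t -> 0 < det2 (derive1 g t) (g s - g t)) \/
            (forall s, g s != g t -> det2 (derive1 g t) (g s - g t) < 0).

(* The curvature is signed, so its positivity also fixes the (counterclockwise)
   orientation of the parametrization. *)
Definition oval (R : realType) (C : set 'rV[R]_2) : Prop :=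
  exists g : R -> 'rV[R]_2,
    [/\ closed_param g C, strictly_convex g & forall t, 0 < curvature g t].

(* The direction of the tangent line to [C] at [x]. *)
Definition tangent_dir (R : realType) (C : set 'rV[R]_2) (x : 'rV[R]_2) :
    set 'rV[R]_2 :=
  [set v | exists g t k, [/\ closed_param g C, g t = x & v = k *: derive1 g t]].

(* Tangent lines are parallel when they have the same direction. *)
Definition iotaC (R : realType) (C : set 'rV[R]_2) (x : 'rV[R]_2) : 'rV[R]_2 :=
  xget x [set y | [/\ C y, y != x & tangent_dir C y = tangent_dir C x]].

Definition secant (R : realType) (C : set 'rV[R]_2) : set (line R) :=
  [set l | exists x y, x != y /\ points l `&` C = [set x; y]].

(* Well defined on secants of an oval by [affine_reflection_join] below. *)
Definition affine_reflection (R : realType) (C : set 'rV[R]_2) (l : line R) :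
    line R :=
  xget l [set m | exists x y,
    [/\ C x, C y, x != y, l = join x y & m = join (iotaC C x) (iotaC C y)]].

Definition affine_map (R : realType) (M : 'M[R]_2) (b p : 'rV[R]_2) :
  'rV[R]_2 := p *m M + b.

(* With points as rows (p, 1), the affine map is right multiplication by the
   block matrix below, so it acts on line coordinates by its inverse
   transpose; see [points_affine_line]. *)
Definition affine_line (R : realType) (M : 'M[R]_2) (b : 'rV[R]_2)
    (l : line R) : line R :=
  mkline (coords l *m trmx (invmx (block_mx M 0 b 1%:M : 'M[R]_(2 + 1)))).

Lemma coords_neq0 (R : realType) (l : line R) : coords l != 0.
Proof. exact: nzval_neq0. Qed.

Lemma coords_mkline (R : realType) (v : 'rV[R]_3) : v != 0 ->
  exists2 k : R, k != 0 & coords (mkline v) = k *: v.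
Proof.
move=> v0; rewrite /coords /mkline.
set w := insubd _ v; have wv : nzval w = v by exact: insubdK.
have /eqmodP/asboolP[k k0 e] : repr (\pi_(line R) w) = w %[mod line R].
  by rewrite reprK.
by exists k; rewrite // e wv.
Qed.

Lemma mklineZ (R : realType) (k : R) (v : 'rV[R]_3) : k != 0 -> v != 0 ->
  mkline (k *: v) = mkline v.
Proof.
move=> k0 v0; apply/eqmodP/asboolP; exists k => //.
have kv0 : k *: v != 0 by rewrite scaler_eq0 negb_or k0.
by rewrite -[RHS]/(k *: val _) -[LHS]/(val _) !insubdK.
Qed.

Lemma coordsK (R : realType) : cancel (@coords R) (@mkline R).
Proof.
move=> l; rewrite -[RHS]reprK /mkline; congr (\pi _).
by apply: val_inj; rewrite insubdK //; exact: coords_neq0.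
Qed.

Lemma points_mkline (R : realType) (v : 'rV[R]_3) : v != 0 ->
  points (mkline v) =
  [set p | v 0 0 * p 0 0 + v 0 1 * p 0 1 + v 0 ord_max = 0].
Proof.
move=> v0; have [k k0 e] := coords_mkline v0; rewrite /points e.
apply/seteqP; split=> p /=; rewrite !mxE => h.
  by apply: (mulfI k0); rewrite mulr0 -h; ring.
by rewrite -!mulrA -!mulrDr h mulr0.
Qed.

Lemma join_neq0 (R : realType) (x y : 'rV[R]_2) : x != y ->
  \row_(k < 3) [:: x 0 1 - y 0 1; y 0 0 - x 0 0;
                   x 0 0 * y 0 1 - x 0 1 * y 0 0]`_k != 0.
Proof.
apply: contraNneq => /rowP h; apply/eqP/rowP => i.
have := h 0; have := h 1; rewrite !mxE /= => h1 h0.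
case: i => [[|[|//]] Hi].
  rewrite (_ : Ordinal Hi = 0); last exact: val_inj.
  by apply/eqP; rewrite eq_sym -subr_eq0 h1.
rewrite (_ : Ordinal Hi = 1); last exact: val_inj.
by apply/eqP; rewrite -subr_eq0 h0.
Qed.

Lemma points_join (R : realType) (x y : 'rV[R]_2) : x != y ->
  points (join x y) = [set p | det2 (y - x) (p - x) = 0].
Proof.
move=> xy; rewrite points_mkline ?join_neq0 //.
by apply/seteqP; split=> p /=; rewrite /det2 !mxE /= => h; rewrite -h; ring.
Qed.

Lemma joinC (R : realType) (x y : 'rV[R]_2) : join x y = join y x.
Proof.
have [->//|xy] := eqVneq x y.
rewrite /join -[RHS](@mklineZ _ (-1)) ?oppr_eq0 ?oner_neq0 //; last first.
  by rewrite join_neq0 // eq_sym.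
by congr mkline; apply/rowP => -[[|[|[|//]]] ?]; rewrite !mxE /=; ring.
Qed.

Lemma chartK (R : realType) (i : 'I_3) (l : line R) :
  chart_dom i l -> unchart i (chart i l) = l.
Proof.
rewrite /chart_dom /= => li; rewrite /unchart -[RHS]coordsK.
rewrite -(@mklineZ _ (coords l 0 i)^-1 (coords l)) ?invr_eq0 ?coords_neq0 //.
congr mkline; apply/rowP => k; rewrite !mxE.
by case: unliftP => [j|] ->; rewrite ?mxE mulrC // divff.
Qed.

Lemma unchartK (R : realType) (i : 'I_3) (u : 'rV[R]_2) :
  chart_dom i (unchart i u) /\ chart i (unchart i u) = u.
Proof.
set v : 'rV_3 := \row_(k < 3) if unlift i k is Some j then u 0 j else 1.
have vi : v 0 i = 1 by rewrite mxE unlift_none.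
have v0 : v != 0.
  by apply/eqP => /rowP/(_ i) /eqP; rewrite vi mxE oner_eq0.
have [k k0 e] := coords_mkline v0; rewrite /chart_dom /chart /unchart -/v /= e.
split; first by rewrite mxE vi mulr1.
by apply/rowP => j; rewrite !mxE unlift_none liftK mulr1 mulrAC divff // mul1r.
Qed.

Lemma pointsE (R : realType) (l : line R) (p : 'rV[R]_2) :
  points l p <->
  coords l *m trmx (row_mx p (1%:M : 'M[R]_1) : 'rV[R]_(2 + 1)) = 0.
Proof.
have e : (coords l *m trmx (row_mx p (1%:M : 'M[R]_1) : 'rV[R]_(2 + 1))) 0 0
    = coords l 0 0 * p 0 0 + coords l 0 1 * p 0 1 + coords l 0 ord_max.
  rewrite mxE (@big_split_ord _ _ _ 2 1) /= !big_ord_recr !big_ord0 /=.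
  rewrite !add0r !(mxE trmx_key) (row_mxEl p) (row_mxEl p) (row_mxEr p).
  rewrite [X in _ + _ * X = _]mxE mulr1.
  by congr (coords l 0 _ * p _ _ + coords l 0 _ * p _ _ + coords l 0 _);
    exact: val_inj.
rewrite /points /= -e; split=> [h|->]; last by rewrite mxE.
by apply/matrixP => i j; rewrite !ord1 h mxE.
Qed.

Lemma points_affine_line (R : realType) (M : 'M[R]_2) (b : 'rV[R]_2)
    (l : line R) : M \in unitmx ->
  points (affine_line M b l) = affine_map M b @` points l.
Proof.
move=> Mu; set B := (block_mx M 0 b 1%:M : 'M[R]_(2 + 1)).
have Bu : B \in unitmx by rewrite unitmxE det_lblock det1 mulr1 -unitmxE.
set v := coords l *m trmx (invmx B).
have v0 : v != 0.
  apply/eqP => e; have := coords_neq0 l; suff -> : coords l = 0 by rewrite eqxx.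
  have : v *m trmx B = 0 by rewrite e mul0mx.
  by rewrite -mulmxA -trmx_mul mulmxV // trmx1 mulmx1.
have hom p : row_mx (affine_map M b p) (1%:M : 'M[R]_1) = row_mx p 1%:M *m B.
  by rewrite mul_row_block mulmx0 add0r !mul1mx.
have key p : points (affine_line M b l) (affine_map M b p) <-> points l p.
  rewrite !pointsE hom trmx_mul.
  have [k k0 ->] := coords_mkline v0.
  rewrite -scalemxAl mulmxA -[v *m _]mulmxA -trmx_mul mulmxV // trmx1 mulmx1.
  split=> [/eqP|->]; last by rewrite scaler0.
  by rewrite scaler_eq0 (negPf k0) => /eqP.
apply/seteqP; split=> [q hq|_ [p hp <-]]; last by apply/key.
have e : affine_map M b ((q - b) *m invmx M) = q.
  by rewrite /affine_map mulmxKV // subrK.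
by exists ((q - b) *m invmx M) => //; apply/key; rewrite e.
Qed.

Lemma oval_tangent (R : realType) (C : set 'rV[R]_2) (a p q : 'rV[R]_2) :
  oval C -> C a -> C p -> C q -> p != a -> q != a ->
  exists v, 0 < det2 v (p - a) * det2 v (q - a).
Proof.
move=> [g [[_ _ _ _ <-] gc _]] [t _ <-] [r _ <-] [s _ <-] pa qa.
exists (derive1 g t); have [h|h] := gc t; first by rewrite mulr_gt0 ?h.
by rewrite nmulr_rgt0 ?h.
Qed.

Lemma middle_point (R : realType) (s U V W : R) :
  0 < - s * W * ((1 - s) * W) -> 0 < - V * ((s - 1) * V) ->
  0 < U * (s * U) -> False.
Proof.
rewrite (_ : - s * W * _ = (s * (s - 1)) * W ^+ 2); last by ring.
rewrite (_ : - V * _ = (1 - s) * V ^+ 2); last by ring.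
rewrite (_ : U * _ = s * U ^+ 2); last by ring.
move=> hw hv hu.
have s0 : 0 < s by rewrite -(pmulr_lgt0 _ (_ : 0 < U ^+ 2)) // lt_def sqr_ge0 andbT;
  apply: contraTneq hu => ->; rewrite mulr0 ltxx.
have s1 : 0 < 1 - s by rewrite -(pmulr_lgt0 _ (_ : 0 < V ^+ 2)) // lt_def sqr_ge0 andbT;
  apply: contraTneq hv => ->; rewrite mulr0 ltxx.
have := mulr_ge0 (ltW (mulr_gt0 s0 s1)) (sqr_ge0 W).
by move: hw; rewrite -opprB mulrN mulNr oppr_gt0 => h /(lt_le_trans h); rewrite ltxx.
Qed.

Lemma points_join_oval (R : realType) (C : set 'rV[R]_2) (x y : 'rV[R]_2) :
  oval C -> C x -> C y -> x != y -> points (join x y) `&` C = [set x; y].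
Proof.
move=> oC Cx Cy xy; rewrite points_join //; apply/seteqP; split=> z /=; last first.
  by case=> ->; split=> //; rewrite /det2 !mxE; ring.
move=> [+ Cz]; have [->|zx] := eqVneq z x; first by left.
have [->|zy] := eqVneq z y; first by right.
have yx : y != x by rewrite eq_sym.
have xz : x != z by rewrite eq_sym.
have yz : y != z by rewrite eq_sym.
have [u] := oval_tangent oC Cx Cy Cz yx zx.
have [v] := oval_tangent oC Cy Cx Cz xy zy.
have [w] := oval_tangent oC Cz Cx Cy xz yz.
have : exists s : R, det2 (y - x) (z - x) = 0 -> z = x + s *: (y - x).
  have [e|n] := eqVneq (y 0 0 - x 0 0) 0.
    have n : y 0 1 - x 0 1 != 0.
      apply: contraNneq xy => e1; apply/eqP/rowP => -[[|[|//]] Hi].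
        rewrite (_ : Ordinal Hi = 0); last exact: val_inj.
        by apply/esym/eqP; rewrite -subr_eq0 e.
      rewrite (_ : Ordinal Hi = 1); last exact: val_inj.
      by apply/esym/eqP; rewrite -subr_eq0 e1.
    exists ((z 0 1 - x 0 1) / (y 0 1 - x 0 1)).
    rewrite /det2 !mxE => h; apply/rowP => -[[|[|//]] Hi].
      rewrite (_ : Ordinal Hi = 0); last exact: val_inj.
      rewrite !mxE e mulr0 addr0.
      move/eqP: h; rewrite e mul0r sub0r oppr_eq0 mulf_eq0 (negPf n) subr_eq0.
      by move/eqP.
    rewrite (_ : Ordinal Hi = 1); last exact: val_inj.
    by rewrite !mxE divfK // addrC subrK.
  exists ((z 0 0 - x 0 0) / (y 0 0 - x 0 0)).
  rewrite /det2 !mxE => h; apply/rowP => -[[|[|//]] Hi].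
    rewrite (_ : Ordinal Hi = 0); last exact: val_inj.
    by rewrite !mxE divfK // addrC subrK.
  rewrite (_ : Ordinal Hi = 1); last exact: val_inj.
  move/eqP: h; rewrite subr_eq0 => /eqP h.
  rewrite !mxE mulrAC [(_ - _) * (y 0 1 - _)]mulrC -h mulrAC divff // mul1r.
  by rewrite addrC subrK.
move=> [s hs] hw hv hu /hs e; exfalso; move: hw hv hu.
set d := y - x; have -> : z - x = s *: d by rewrite e addrC addKr.
have -> : x - y = - d by rewrite opprB.
have -> : z - y = (s - 1) *: d by apply/rowP => i; rewrite e !mxE; ring.
have -> : x - z = - s *: d by apply/rowP => i; rewrite e !mxE; ring.
have -> : y - z = (1 - s) *: d by apply/rowP => i; rewrite e !mxE; ring.
have Z a k : det2 a (k *: d) = k * det2 a d by rewrite /det2 !mxE; ring.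
have N a : det2 a (- d) = - det2 a d by rewrite /det2 !mxE; ring.
rewrite !Z N.
exact: middle_point.
Qed.

Lemma join_unique (R : realType) (x y : 'rV[R]_2) (l : line R) :
  x != y -> points l x -> points l y -> l = join x y.
Proof.
move=> xy; rewrite /points /= => hx hy; rewrite -[LHS]coordsK.
have {hx}hx : coords l 0 ord_max = - (coords l 0 0 * x 0 0 + coords l 0 1 * x 0 1).
  by apply/eqP; rewrite -addr_eq0 addrC hx.
have hd : coords l 0 0 * (x 0 0 - y 0 0) = coords l 0 1 * (y 0 1 - x 0 1).
  by apply/eqP; rewrite -subr_eq0 -oppr_eq0 -[X in _ == X]hy hx; apply/eqP; ring.
suff [k e] : exists k, coords l = k *:
    \row_(k < 3) [:: x 0 1 - y 0 1; y 0 0 - x 0 0;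
                     x 0 0 * y 0 1 - x 0 1 * y 0 0]`_k.
  rewrite e mklineZ ?join_neq0 //; apply: contraTneq (coords_neq0 l) => k0.
  by rewrite e k0 scale0r eqxx.
have [e1|n1] := eqVneq (x 0 1 - y 0 1) 0; last first.
  have h1 : coords l 0 1 = coords l 0 0 / (x 0 1 - y 0 1) * (y 0 0 - x 0 0).
    apply: (mulIf n1); rewrite mulrAC divfK //.
    by rewrite -opprB mulrN -hd -mulrN opprB.
  exists (coords l 0 0 / (x 0 1 - y 0 1)); apply/rowP => -[[|[|[|//]]] Hi].
  - by rewrite (_ : Ordinal Hi = 0) ?mxE /= ?divfK //; exact: val_inj.
  - by rewrite (_ : Ordinal Hi = 1) ?mxE //=; exact: val_inj.
  - rewrite (_ : Ordinal Hi = ord_max) ?mxE /=; last exact: val_inj.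
    by rewrite hx h1; field.
have e1' : y 0 1 = x 0 1 by apply/esym/eqP; rewrite -subr_eq0 e1.
have n0 : y 0 0 - x 0 0 != 0.
  apply: contraNneq xy => e0; apply/eqP/rowP => -[[|[|//]] Hi].
    rewrite (_ : Ordinal Hi = 0); last exact: val_inj.
    by apply/esym/eqP; rewrite -subr_eq0 e0.
  rewrite (_ : Ordinal Hi = 1); last exact: val_inj.
  by rewrite e1'.
have h0 : coords l 0 0 = 0.
  apply: (mulIf n0); rewrite mul0r -opprB mulrN hd e1' subrr mulr0 oppr0 //.
exists (coords l 0 1 / (y 0 0 - x 0 0)); apply/rowP => -[[|[|[|//]]] Hi].
- by rewrite (_ : Ordinal Hi = 0) ?mxE /= ?e1 ?mulr0 ?h0 //; exact: val_inj.
- by rewrite (_ : Ordinal Hi = 1) ?mxE /= ?divfK //; exact: val_inj.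
- rewrite (_ : Ordinal Hi = ord_max) ?mxE /=; last exact: val_inj.
  by rewrite hx h0 e1'; field.
Qed.

Lemma secantE (R : realType) (C : set 'rV[R]_2) (l : line R) : oval C ->
  secant C l <-> exists x y, [/\ C x, C y, x != y & l = join x y].
Proof.
move=> oC; split=> [[x [y [xy h]]]|[x [y [Cx Cy xy ->]]]]; last first.
  by exists x, y; split=> //; exact: points_join_oval.
have /= [lx Cx] : (points l `&` C) x by rewrite h; left.
have /= [ly Cy] : (points l `&` C) y by rewrite h; right.
by exists x, y; split=> //; exact: join_unique.
Qed.

Lemma affine_reflection_join (R : realType) (C : set 'rV[R]_2)
    (x y : 'rV[R]_2) : oval C -> C x -> C y -> x != y ->
  affine_reflection C (join x y) = join (iotaC C x) (iotaC C y).
Proof.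
move=> oC Cx Cy xy; rewrite /affine_reflection; case: xgetP => [m _|/(_ _) h].
  move=> [x' [y' [Cx' Cy' xy' e ->]]].
  have := points_join_oval oC Cx' Cy' xy'.
  rewrite -e (points_join_oval oC Cx Cy xy) => s.
  have : [set x'; y'] x by rewrite -s; left.
  have : [set x'; y'] y by rewrite -s; right.
  move=> /= [ey|ey] [ex|ex]; rewrite ex ey // in xy *; rewrite ?eqxx // in xy.
  exact: joinC.
by case: (h (join (iotaC C x) (iotaC C y))); exists x, y.
Qed.

(* Main.v *)
Require Import Defs.
From mathcomp Require Import all_boot all_order all_algebra.
From mathcomp Require Import all_classical all_reals all_analysis.
From mathcomp Require Import ring lra.
Set Implicit Arguments.
Unset Strict Implicit.
Unset Printing Implicit Defensive.
Import Order.TTheory GRing.Theory Num.Theory.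
Import numFieldNormedType.Exports.
Local Open Scope ring_scope.
Local Open Scope classical_set_scope.

(** The key to every claim is that each tangent line of an oval touches it at a
    single point and keeps the rest strictly on one side. The point farthest
    from a tangent line has a parallel tangent ([exists_parallel]), and a third
    parallel tangent is impossible since the middle one of three would have
    points of the oval on both sides ([parallel_tangents_le2]). So [iotaC] is a
    fixed-point-free involution, and as a secant determines its two end points,
    the reflection is an involution of the secants. A secant is fixed when
    [iotaC] permutes its end points, which it can only do by exchanging them.

    Smoothness rests on one implicit function lemma ([implicit_smooth]): a
    transversal intersection of a line with a smooth plane curve is a smooth
    function of the line. Applied to the oval, it makes the end points of a
    chord smooth functions of the secant; a secant is transversal because the
    tangent line has no second point on the oval. Applied to the hodograph,
    the curve traced by the velocity vector, and to the line through the origin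
    in a tangent direction, it makes the opposite point a smooth function of a
    curve point; transversality now comes from positive curvature. The
    reflected line joins the opposite points, so its homogeneous coordinates
    are smooth in any chart ([reflection_local]), and so are their ratios. The
    same construction shows that lines near a secant are secants. The inverse
    of the reflection is the reflection itself.

    An affine map sends parametrizations of the oval to parametrizations of its
    image and parallel tangents to parallel tangents, so it commutes with
    [iotaC], hence with the reflection. *)

(** * Calculus of C^n functions *)
Section Ck_calculus.
Context {R : realType} {V : normedModType R}.
Implicit Types (f g : V -> R) (U W : set V) (n : nat).

(** Differentiability from an explicit error estimate: this avoids computing
    with the library's choice of ['d f x] before it is known to exist. *)
Lemma differentiable_littleo (W : normedModType R) (f : V -> W)
    (L : {linear V -> W}) (x : V) :
  continuous L ->
  (forall e, 0 < e -> \forall h \near 0, `|f (h + x) - f x - L h| <= e * `|h|) ->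
  differentiable f x.
Proof.
move=> Lc fL.
have dfL : f \o shift x = cst (f x) + L +o_ 0 id.
  apply/eqaddoP => e e0; near=> h => /=.
  rewrite [X in `|X| <= _](_ : _ = f (h + x) - f x - L h).
    by near: h; exact: fL.
  by rewrite !fctE /= opprD addrA.
apply/diff_locallyP; rewrite (diff_unique Lc dfL); split => //.
Unshelve. all: by end_near. Qed.

Lemma near_eq_differentiable (W : normedModType R) (f g : V -> W) (x : V) :
  (\forall y \near x, f y = g y) -> differentiable f x -> differentiable g x.
Proof.
move=> fg df; apply: (@differentiable_littleo _ g ('d f x)).
  exact: diff_continuous.
move=> e e0.
have /diff_locallyP[_ /eqaddoP /(_ e e0) dfx] := df.
have fg0 : \forall h \near (0 : V), f (h + x) = g (h + x).
  by move: fg; rewrite (near_shift 0 x) subr0.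
have fgx : f x = g x := nbhs_singleton fg.
near=> h.
rewrite -fgx.
have <- : f (h + x) = g (h + x) by near: h; exact: fg0.
have -> : f (h + x) - f x - 'd f x h =
   (f \o shift x - (cst (f x) + 'd f x)) h by rewrite !fctE /= opprD addrA.
near: h; exact: dfx.
Unshelve. all: by end_near. Qed.

(** Both differentiability and directional derivatives depend on germs only, so
    on an open set a formula for [f] may replace [f]; all rules below derive the
    C^n property of a derivative from its formula this way. *)
Lemma Ck_eq (W : normedModType R) (U : set V) (f g : V -> W) n :
  open U -> (forall x, U x -> f x = g x) -> Ck n U f -> Ck n U g.
Proof.
move=> oU; elim: n f g => [|n IH] f g fg /=.
  move=> cf x Ux.
  have fgx : \forall y \near x, f y = g y.
    by apply: filterS (open_nbhs_nbhs (conj oU Ux)) => y; exact: fg.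
  change (g @ x --> g x); rewrite -fg //; apply: cvg_trans (cf x Ux).
  by apply: near_eq_cvg; apply: filterS fgx.
move=> [df Df].
have fgx x : U x -> \forall y \near x, f y = g y.
  by move=> Ux; apply: filterS (open_nbhs_nbhs (conj oU Ux)) => y; exact: fg.
split=> [x Ux|v]; first by apply: near_eq_differentiable (df x Ux); exact: fgx.
by apply: IH (Df v) => x Ux; apply: near_eq_derive; exact: fgx.
Qed.

Lemma Ck_sub (W : normedModType R) (U U' : set V) (f : V -> W) n :
  U' `<=` U -> Ck n U f -> Ck n U' f.
Proof.
move=> sU; elim: n f => [|n IH] f /=; first by move=> cf x /sU; exact: cf.
by move=> [df Df]; split=> [x /sU|v]; [exact: df|exact: IH].
Qed.

(** Every clause in the definition of [Ck] is a condition at one point of [U],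
    since the derivatives are taken in the ambient space. Smoothness on an
    arbitrary set can thus be checked near each of its points. *)
Lemma Ck_pointwise (W : normedModType R) (U : set V) (f : V -> W) n :
  (forall x, U x -> Ck n [set x] f) -> Ck n U f.
Proof.
elim: n f => [|n IH] f /= Cf; first by move=> x Ux; exact: (Cf x Ux).
split=> [x Ux|v]; first exact: (Cf x Ux).1.
by apply: IH => x Ux; exact: (Cf x Ux).2.
Qed.

Lemma CkS (W : normedModType R) (U : set V) (f : V -> W) n :
  Ck n.+1 U f -> Ck n U f.
Proof.
elim: n f => [|n IH] f.
  by move=> [df _] x Ux; apply: differentiable_continuous; exact: df.
by move=> [df Df]; split=> // v; exact: IH.
Qed.

Lemma Ck_cst (W : normedModType R) (U : set V) (k : W) n :
  Ck n U (fun=> k : W).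
Proof.
elim: n k => [|n IH] k; first by move=> x _; exact: cvg_cst.
split=> [x _|v]; first exact: differentiable_cst.
rewrite (_ : (fun x : V => 'D_v (fun=> k : W) x) = fun=> 0); first exact: IH.
by apply/funext => x; rewrite derive_cst.
Qed.

Lemma CkD U f g n : open U -> Ck n U f -> Ck n U g ->
  Ck n U (fun x => f x + g x).
Proof.
move=> oU; elim: n f g => [|n IH] f g.
  by move=> cf cg x Ux; apply: cvgD; [exact: cf|exact: cg].
move=> [df Df] [dg Dg]; split=> [x Ux|v].
  by apply: differentiableD; [exact: df|exact: dg].
apply: (Ck_eq oU) (IH _ _ (Df v) (Dg v)) => x Ux.
by rewrite -deriveD //; apply: diff_derivable; [exact: df|exact: dg].
Qed.

Lemma CkM U f g n : open U -> Ck n U f -> Ck n U g ->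
  Ck n U (fun x => f x * g x).
Proof.
move=> oU; elim: n f g => [|n IH] f g.
  by move=> cf cg x Ux; apply: cvgM; [exact: cf|exact: cg].
move=> [df Df] [dg Dg]; split=> [x Ux|v].
  by apply: differentiableM; [exact: df|exact: dg].
have fn : Ck n U f by apply: CkS; split.
have gn : Ck n U g by apply: CkS; split.
apply: (Ck_eq oU) (CkD oU (IH _ _ fn (Dg v)) (IH _ _ gn (Df v))) => x Ux.
by rewrite [RHS]deriveM //; apply: diff_derivable; [exact: df|exact: dg].
Qed.

Lemma CkN U f n : open U -> Ck n U f -> Ck n U (fun x => - f x).
Proof.
move=> oU Cf; rewrite (_ : (fun x => _) = fun x => (-1) * f x).
  by apply: CkM => //; exact: Ck_cst.
by apply/funext => x; rewrite mulN1r.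
Qed.

Lemma CkV U f n : open U -> (forall x, U x -> f x != 0) -> Ck n U f ->
  Ck n U (fun x => (f x)^-1).
Proof.
move=> oU f0; elim: n => [|n IH].
  by move=> cf x Ux; apply: cvgV; [exact: f0|exact: cf].
move=> Cf; have [df Df] := Cf; split=> [x Ux|v].
  by apply: differentiableV; [exact: df|exact: f0].
have Cn := IH (CkS Cf).
apply: (Ck_eq oU) (CkN oU (CkM oU (CkM oU Cn Cn) (Df v))) => x Ux.
rewrite [RHS]deriveV ?f0 //; last by apply: diff_derivable; exact: df.
by rewrite /GRing.scale /= expr2 invfM mulNr.
Qed.

(** The induction is on all outer functions at once, as the chain rule replaces
    [h] by its derivative. *)
Lemma Ck_comp (h : R -> R) U f n : open U ->
  (forall m t, derivable (derive1n m h) t 1) -> Ck n U f ->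
  Ck n U (fun x => h (f x)).
Proof.
move=> oU; elim: n h => [|n IH] h sh.
  move=> cf x Ux; apply: continuous_comp; first exact: cf.
  apply: differentiable_continuous; apply/derivable1_diffP; exact: (sh 0%N).
move=> Cf; have [df Df] := Cf; split=> [x Ux|v].
  apply: (@differentiable_comp _ _ _ _ f h); first exact: df.
  by apply/derivable1_diffP; exact: (sh 0%N).
have sh' m t : derivable (derive1n m (derive1 h)) t 1.
  by rewrite -derive1Sn; exact: sh.
apply: (Ck_eq oU) (CkM oU (IH _ sh' (CkS Cf)) (Df v)) => x Ux.
have dh : differentiable h (f x) by apply/derivable1_diffP; exact: (sh 0%N).
rewrite [RHS]deriveE; last by apply: differentiable_comp => //; exact: df.
rewrite (diff_comp (df x Ux) dh) /= deriveE; last exact: df.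
by rewrite derive1E' // -[in RHS](mulr1 ('d f x v)) [RHS]linearZ /= mulrC.
Qed.

Lemma Ck_row m U (f : V -> 'rV[R]_m) n : open U ->
  (forall j, Ck n U (fun x => f x 0 j)) -> Ck n U f.
Proof.
move=> oU; elim: n f => [|n IH] f Cf.
  move=> x Ux; apply/cvgrPdist_le => /= e e0.
  near=> y.
  rewrite /Num.Def.normr/= mx_normrE (bigmax_le _ (ltW e0))//= => i _.
  rewrite !mxE/= (ord1 i.1).
  move: i; near: y; apply: filter_forall => /= i.
  exact: ((cvgrPdist_le _ _).1 (Cf i.2 x Ux)).
have df x : U x -> differentiable f x.
  move=> Ux.
  have fE : f = (fun y => \sum_(j < m) (f y 0 j *: (delta_mx 0 j : 'rV[R]_m))).
    by apply/funext => y; rewrite [LHS]row_sum_delta.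
  rewrite fE.
  rewrite (_ : (fun y => _) =
      \sum_(j < m) (fun y => f y 0 j *: (delta_mx 0 j : 'rV[R]_m))).
    apply: differentiable_sum => j; apply: differentiableZl.
    exact: (Cf j).1.
  by apply/funext => y; rewrite fct_sumE.
split=> // v; apply: IH => j.
apply: (Ck_eq oU) ((Cf j).2 v) => x Ux.
by rewrite derive_mx ?mxE //; apply: diff_derivable; exact: df.
Unshelve. all: by end_near. Qed.

Lemma Ck_entry m U (f : V -> 'rV[R]_m.+1) j n : open U ->
  Ck n U f -> Ck n U (fun x => f x 0 j).
Proof.
move=> oU; elim: n f => [|n IH] f.
  move=> cf x Ux.
  exact: (continuous_comp (cf x Ux) (@coord_continuous _ _ _ 0 j (f x))).
move=> [df Df]; split=> [x Ux|v].
  exact: (differentiable_comp (df x Ux) (differentiable_coord (f x) 0 j)).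
apply: (Ck_eq oU) (IH _ (Df v)) => x Ux.
by rewrite derive_mx ?mxE //; apply: diff_derivable; exact: df.
Qed.

End Ck_calculus.

Lemma Ck_coord (R : realType) m (U : set 'rV[R]_m.+1) j n :
  Ck n U (fun u : 'rV[R]_m.+1 => u 0 j).
Proof.
case: n => [|n]; first by move=> x _; exact: coord_continuous.
split=> [x _|v]; first exact: differentiable_coord.
rewrite (_ : (fun x => _) = fun=> v 0 j); first exact: Ck_cst.
apply/funext => x.
have := @derive_mx _ _ _ _ id x v (@derivable_id _ _ x v).
by rewrite derive_id => {2}->; rewrite mxE.
Qed.

(** * Smoothness near a point *)
(** Equivalent to smoothness on some open neighbourhood of [x] by
    [smooth_nearP]; this form composes with the filter of neighbourhoods. *)
Definition smooth_near (R : realType) (V W : normedModType R) (x : V)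
  (f : V -> W) := \forall y \near x, smooth_on [set y] f.

Lemma smooth_nearP (R : realType) (V W : normedModType R) (x : V) (f : V -> W) :
  smooth_near x f <-> exists U, [/\ open U, U x & smooth_on U f].
Proof.
split=> [/nbhs_interior sf|[U [oU Ux Uf]]].
  exists (interior [set y | smooth_on [set y] f]); split.
  - exact: open_interior.
  - exact: nbhs_singleton sf.
  - by move=> n; apply: Ck_pointwise => y /interior_subset; exact.
apply: filterS (open_nbhs_nbhs (conj oU Ux)) => y Uy n.
by apply: Ck_sub (Uf n) => _ ->.
Qed.

Definition smooth_fun (R : realType) (h : R -> R) :=
  forall n t, derivable (derive1n n h) t 1.

Lemma smooth_fun_derive1 (R : realType) (h : R -> R) :
  smooth_fun h -> smooth_fun (derive1 h).
Proof. by move=> sh n t; rewrite -derive1Sn; exact: sh. Qed.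

Lemma smooth_fun_continuous (R : realType) (h : R -> R) :
  smooth_fun h -> continuous h.
Proof.
move=> sh t; apply: differentiable_continuous; apply/derivable1_diffP.
exact: (sh 0%N).
Qed.

(** At a zero of [f] the increment of [f * g] is [g x] times that of [f] up to a
    negligible term, so [g] contributes its value only, not its derivative. *)
Lemma differentiable_mul0 (R : realType) (V : normedModType R) (f g : V -> R) x :
  differentiable f x -> f x = 0 -> {for x, continuous g} ->
  differentiable (fun y => f y * g y) x.
Proof.
move=> df fx cg.
pose L : {linear V -> R} := g x \*: 'd f x.
apply: (@differentiable_littleo _ _ _ _ L) => [v|e e0].
  by apply: (@cvgM _ _ _ _ (cst (g x))); [exact: cvg_cst|exact: diff_continuous].
have [K K0 dfK] := linear_lipschitz (diff_continuous df).
have gx1 : 0 < `|g x| + 1 by rewrite ltr_wpDl.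
have K1 : 0 < K + 1 by rewrite addr_gt0.
have /diff_locallyP[_ /eqaddoP dfo] := df.
have e1 : 0 < e / 2 / (`|g x| + 1) by rewrite !divr_gt0.
have e2 : 0 < e / 2 / (K + 1) by rewrite !divr_gt0.
have cg0 : \forall h \near (0 : V), `|g x - g (h + x)| <= e / 2 / (K + 1).
  have : \forall y \near x, `|g x - g y| <= e / 2 / (K + 1).
    by have /cvgrPdist_le/(_ _ e2) := cg.
  by rewrite (near_shift 0 x) subr0.
near=> h.
have E h' : (f \o shift x - (cst (f x) + 'd f x)) h' = f (h' + x) - 'd f x h'.
  by rewrite !fctE /= fx add0r.
have B1 : `|f (h + x) - 'd f x h| <= e / 2 / (`|g x| + 1) * `|h|.
  by rewrite -E; near: h; exact: dfo.
have B2 : `|f (h + x)| <= (K + 1) * `|h|.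
  rewrite -[f _](subrK ('d f x h)) mulrDl mul1r addrC.
  rewrite (le_trans (ler_normD _ _)) // lerD //.
  by rewrite -[leRHS]mul1r -E; near: h; exact: dfo.
have B3 : `|g x - g (h + x)| <= e / 2 / (K + 1) by near: h.
rewrite fx mul0r subr0 -[L h]/(g x * 'd f x h).
rewrite (_ : _ - _ = (f (h + x) - 'd f x h) * g x - f (h + x) * (g x - g (h + x))).
  rewrite (le_trans (ler_normB _ _)) // !normrM (splitr e) mulrDl lerD //.
    rewrite (le_trans (ler_wpM2r (normr_ge0 _) B1)) //.
    rewrite mulrAC ler_wpM2r // mulrAC ler_pdivrMr //.
    by rewrite ler_wpM2l ?lerDl // ltW // divr_gt0.
  rewrite (le_trans (ler_pM (normr_ge0 _) (normr_ge0 _) B2 B3)) //.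
  by rewrite mulrAC mulrC [(K + 1) * _]mulrC divfK ?gt_eqF // mulrC.
by ring.
Unshelve. all: by end_near. Qed.

(** Caratheodory's form of the derivative. *)
Lemma slope_continuous (R : realType) (h : R -> R) (t : R) :
  derivable h t 1 ->
  exists s : R -> R, [/\ {for t, continuous s}, s t = derive1 h t &
    forall r, h r - h t = s r * (r - t)].
Proof.
move=> dh.
exists (fun r => if r == t then derive1 h t else (h r - h t) / (r - t)).
split; last first.
- move=> r; case: eqVneq => [->|rt]; first by rewrite !subrr mulr0.
  by rewrite divfK // subr_eq0.
- by rewrite eqxx.
- apply/cvgrPdist_le => e e0; rewrite eqxx.
  have /derivable1_diffP dh' := dh.
  have /diff_locallyP[_ /eqaddoP /(_ e e0) H] := dh'.
  have {}H : \forall k \near (0 : R),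
    `|(h \o shift t - (cst (h t) + 'd h t)) k| <= e * `|k| by exact: H.
  rewrite (near_shift t 0) /= sub0r in H; near=> r.
  case: eqVneq => [_|rt]; first by rewrite subrr normr0 ltW.
  have : `|(h \o shift t - (cst (h t) + 'd h t)) (r - t)| <= e * `|r - t|.
    by near: r.
  rewrite !fctE /= subrK -[X in 'd h t X]mulr1 [in X in X -> _]linearZ /=.
  rewrite -derive1E' // => K.
  have rt0 : r - t != 0 by rewrite subr_eq0.
  rewrite -(ler_pM2r (_ : 0 < `|r - t|)) ?normr_gt0 //.
  rewrite -normrM mulrBl divfK // [leLHS]distrC.
  by move: K; rewrite opprD addrA [_ *: _]mulrC.
Unshelve. all: by end_near. Qed.

(** * Moving intersections of a line with a curve *)

(** The curve [(p, q)] meets the moving line of coordinates [a u, b u, c u] at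
   the parameters where [F u] vanishes, and [Ft u] is the derivative of [F u]:
   it is nonzero where the line crosses the curve transversally. *)
Section implicit_function.
Context {R : realType} {V : normedModType R}.
Variables (a b c : V -> R) (p q : R -> R).
Hypotheses (sp : smooth_fun p) (sq : smooth_fun q).

Let F u t := a u * p t + b u * q t + c u.
Let Ft u t := a u * derive1 p t + b u * derive1 q t.

Let FtE (u : V) (t : R) : is_derive t (1 : R) (F u) (Ft u t).
Proof.
have Dp : is_derive t 1 p (derive1 p t).
  by rewrite derive1E; apply: derivableP; exact: (@sp 0%N t).
have Dq : is_derive t 1 q (derive1 q t).
  by rewrite derive1E; apply: derivableP; exact: (@sq 0%N t).
have Zp : is_derive t (1 : R) (fun s => a u * p s) (a u * derive1 p t).
  exact: is_deriveZ.
have Zq : is_derive t (1 : R) (fun s => b u * q s) (b u * derive1 q t).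
  exact: is_deriveZ.
have D := is_deriveD (is_deriveD Zp Zq) (is_derive_cst (c u) t (1 : R)).
by apply: is_derive_eq D _; rewrite addr0.
Qed.

Let F_increasing u x y :
  (forall t, t \in `[x, y]%R -> 0 < Ft u t) -> x < y -> F u x < F u y.
Proof.
move=> Fp xy; apply: (@gtr0_derive1_lt_cc _ (F u) x y).
- by move=> t _; have [] := FtE u t.
- move=> t txy; rewrite derive1E; have [_ ->] := FtE u t; apply: Fp.
  by move: txy; rewrite !in_itv /= => /andP[/ltW -> /ltW ->].
- apply: derivable_within_continuous => t _; by have [] := FtE u t.
- by rewrite in_itv /= lexx ltW.
- by rewrite in_itv /= lexx ltW.
- by [].
Qed.

Let F_cont u t : {for u, continuous a} -> {for u, continuous b} ->
  {for u, continuous c} -> {for u, continuous (F ^~ t)}.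
Proof.
move=> ca cb cc; apply: cvgD => //.
by apply: cvgD; apply: cvgM => //; exact: cvg_cst.
Qed.

(** On a fixed interval around [t0] and for [u] close to [u0], the function
    [F u] is increasing and changes sign; the intermediate value theorem gives
    its unique zero. Monotonicity also turns the sign of [F v] at the two
    parameters next to [T u] into the continuity of [T]. *)
Lemma implicit_continuous (U : set V) (u0 : V) (t0 : R) :
  open U -> U u0 -> {in U, continuous a} -> {in U, continuous b} ->
  {in U, continuous c} -> F u0 t0 = 0 -> 0 < Ft u0 t0 ->
  exists (W : set V) (T : V -> R), [/\ open W, W u0, W `<=` U, T u0 = t0 &
    forall u, W u -> [/\ F u (T u) = 0, Ft u (T u) != 0 &
      {for u, continuous T}]].
Proof.
move=> oU Uu0 ca cb cc F0 Ft0.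
have near0 : \forall u \near u0, U u by exact: open_nbhs_nbhs.
have [d d0 Fpos] : exists2 d : R, 0 < d &
    (\forall u \near u0, forall t, `|t0 - t| <= d -> 0 < Ft u t).
  have Uin := mem_set Uu0.
  have sp' := smooth_fun_derive1 sp.
  have sq' := smooth_fun_derive1 sq.
  have cf (h : V -> R) : {for u0, continuous h} ->
      (fun z : V * R => h z.1) @ (u0, t0) --> h u0.
    move=> ch; apply: (@cvg_comp _ _ _ fst h _ (nbhs u0)); last exact: ch.
    exact: (@cvg_fst _ _ (nbhs u0) (nbhs t0)).
  have cs (h : R -> R) : smooth_fun h ->
      (fun z : V * R => h z.2) @ (u0, t0) --> h t0.
    move=> /smooth_fun_continuous ch.
    apply: (@cvg_comp _ _ _ snd h _ (nbhs t0)); last exact: ch.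
    exact: (@cvg_snd _ _ (nbhs u0) (nbhs t0)).
  have cFt : (fun z : V * R => Ft z.1 z.2) @ (u0, t0) --> Ft u0 t0.
    by apply: cvgD; apply: cvgM;
      [exact: cf (ca _ Uin)|exact: cs|exact: cf (cb _ Uin)|exact: cs].
  have [[A B] /= [nA nB] AB] := cvgr_gt _ cFt _ Ft0.
  have /nbhs_ballP[e /= e0 eB] := nB.
  exists (e / 2); first by rewrite divr_gt0.
  apply: filterS nA => u Au t tt0.
  apply: (AB (u, t)); split => //=; apply: eB.
  rewrite -ball_normE /= (le_lt_trans tt0) // ltr_pdivrMr //.
  by rewrite ltr_pMr // ltr1n.
set x := t0 - d; set y := t0 + d.
have xt0 : x < t0 by rewrite ltrBlDr ltrDl.
have t0y : t0 < y by rewrite ltrDl.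
have xyE t : (t \in `[x, y]%R) = (`|t0 - t| <= d).
  by rewrite in_itv /= ler_distlC.
pose G u := [/\ U u, forall t, `|t0 - t| <= d -> 0 < Ft u t,
  F u x < 0 & 0 < F u y].
have nG : \forall u \near u0, G u.
  have Fx : F u0 x < 0.
    rewrite -F0; apply: F_increasing => // t txy.
    apply: (nbhs_singleton Fpos).
    rewrite -xyE; move: txy; rewrite !in_itv /= => /andP[-> /= /le_trans ->] //.
    exact: ltW.
  have Fy : 0 < F u0 y.
    rewrite -F0; apply: F_increasing => // t txy.
    apply: (nbhs_singleton Fpos).
    rewrite -xyE; move: txy; rewrite !in_itv /= => /andP[+ ->] /=.
    by rewrite andbT; apply: le_trans; exact: ltW.
  have Uin := mem_set Uu0.
  have Fcx := @F_cont u0 x (ca _ Uin) (cb _ Uin) (cc _ Uin).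
  have Fcy := @F_cont u0 y (ca _ Uin) (cb _ Uin) (cc _ Uin).
  have nx := cvgr_lt _ Fcx _ Fx.
  have ny := cvgr_gt _ Fcy _ Fy.
  near=> u; split; near: u; [exact: near0|exact: Fpos|exact: nx|exact: ny].
have mono u s t : G u -> s \in `[x, y]%R -> t \in `[x, y]%R -> s < t ->
    F u s < F u t.
  move=> [_ Fp _ _]; rewrite !in_itv /= => /andP[xs sy] /andP[xt ty] st.
  apply: F_increasing => // r; rewrite in_itv /= => /andP[sr rt].
  by apply: Fp; rewrite -xyE in_itv /= (le_trans xs sr) (le_trans rt ty).
have xyx : x \in `[x, y]%R by rewrite in_itv /= lexx ltW // (lt_trans xt0 t0y).
have xyy : y \in `[x, y]%R by rewrite in_itv /= lexx ltW // (lt_trans xt0 t0y).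
pose T u := xget t0 [set t | t \in `[x, y]%R /\ F u t = 0].
have TP u : G u -> T u \in `[x, y]%R /\ F u (T u) = 0.
  move=> [_ _ Fx Fy]; rewrite /T; case: xgetP => [t _ []//|H]; exfalso.
  have [] := @IVT _ (F u) x y 0.
  - by rewrite ltW // (lt_trans xt0 t0y).
  - apply: derivable_within_continuous => t _; by have [] := FtE u t.
  - by rewrite ge_min le_max (ltW Fx) (ltW Fy) orbT.
  - by move=> t txy Ft0'; apply: (H t).
have T_lt u t : G u -> t \in `[x, y]%R -> F u t < 0 -> t < T u.
  move=> Gu txy Fut; have [Txy FT] := TP u Gu.
  rewrite ltNge; apply/negP; rewrite le_eqVlt => /predU1P[Tt|Tt].
    by move: Fut; rewrite -Tt FT ltxx.
  by have := lt_trans (mono _ _ _ Gu Txy txy Tt) Fut; rewrite FT ltxx.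
have T_gt u t : G u -> t \in `[x, y]%R -> 0 < F u t -> T u < t.
  move=> Gu txy Fut; have [Txy FT] := TP u Gu.
  rewrite ltNge; apply/negP; rewrite le_eqVlt => /predU1P[Tt|Tt].
    by move: Fut; rewrite Tt FT ltxx.
  by have := lt_trans Fut (mono _ _ _ Gu txy Txy Tt); rewrite FT ltxx.
exists (interior [set u | G u]), T; split.
- exact: open_interior.
- exact: nG.
- by move=> u /interior_subset [].
- have G0 := nbhs_singleton nG.
  have txy : t0 \in `[x, y]%R by rewrite in_itv /= !ltW.
  have [Txy FT] := TP _ G0.
  have [Tt|Tt|//] := ltgtP (T u0) t0.
    by have := mono _ _ _ G0 Txy txy Tt; rewrite FT F0 ltxx.
  by have := mono _ _ _ G0 txy Txy Tt; rewrite FT F0 ltxx.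
move=> u Wu; have Gu := interior_subset Wu.
have [Txy FT] := TP _ Gu.
split=> //; first by case: Gu => _ Fp _ _; rewrite gt_eqF // Fp // -xyE.
apply/cvgrPdist_le => /= e e0.
have Uin : u \in U by apply: mem_set; case: Gu.
have [_ _ Fx Fy] := Gu.
have xT : x < T u by apply: T_lt.
have Ty : T u < y by apply: T_gt.
pose s := Num.max x (T u - e); pose r := Num.min y (T u + e).
have sT : s < T u by rewrite gt_max xT ltrBlDr ltrDl.
have Tr : T u < r by rewrite lt_min Ty ltrDl.
have sxy : s \in `[x, y]%R.
  by rewrite in_itv /= le_max lexx /= ltW // (lt_trans sT).
have rxy : r \in `[x, y]%R.
  by rewrite in_itv /= ge_min lexx /= andbT ltW // (lt_trans xT).
have Fs : F u s < 0 by rewrite -FT; apply: mono.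
have Fr : 0 < F u r by rewrite -FT; apply: mono.
have Fcs := @F_cont u s (ca _ Uin) (cb _ Uin) (cc _ Uin).
have Fcr := @F_cont u r (ca _ Uin) (cb _ Uin) (cc _ Uin).
have ns := cvgr_lt _ Fcs _ Fs.
have nr := cvgr_gt _ Fcr _ Fr.
near=> v.
have Gv : G v by near: v; exact: Wu.
have sv : s < T v by apply: T_lt => //; near: v; exact: ns.
have vr : T v < r by apply: T_gt => //; near: v; exact: nr.
rewrite distrC ler_distl; apply/andP; split.
  by apply: ltW; apply: le_lt_trans sv; rewrite le_max lexx orbT.
by apply: ltW; apply: lt_le_trans vr _; rewrite ge_min lexx orbT.
Unshelve. all: by end_near. Qed.

(** Replacing the increments of [p] and [q] by slopes solves the equation for
    [T v]: it is [T u - N v / D v], where [N v] is the value at [v] of the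
    equation with frozen parameter [T u]. Here [N] is differentiable and
    vanishes at [u], while [D] is only known to be continuous, which suffices
    by [differentiable_mul0]. *)
Lemma implicit_differentiable (W : set V) (T : V -> R) u : open W -> W u ->
  {in W, continuous T} ->
  (forall v, W v -> F v (T v) = 0) -> Ft u (T u) != 0 ->
  differentiable a u -> differentiable b u -> differentiable c u ->
  differentiable T u.
Proof.
move=> oW Wu cT FT Ftu da db dc.
have [P [cP PT Pp]] := slope_continuous (@sp 0%N (T u)).
have [Q [cQ QT Qq]] := slope_continuous (@sq 0%N (T u)).
pose N v := F v (T u).
pose D v := a v * P (T v) + b v * Q (T v).
have cTu := cT _ (mem_set Wu).
have cD : {for u, continuous D}.
  have cd := differentiable_continuous.
  by apply: cvgD; apply: cvgM; try (exact: cd); exact: continuous_comp.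
have Du : D u != 0 by rewrite /D PT QT.
have dN : differentiable N u.
  exact: (differentiableD (differentiableD
    (differentiableM da (differentiable_cst (p (T u)) u))
    (differentiableM db (differentiable_cst (q (T u)) u))) dc).
have Nu : N u = 0 by exact: FT.
have dND : differentiable (fun v => N v * (D v)^-1) u.
  by apply: differentiable_mul0 => //; exact: cvgV.
apply: (@near_eq_differentiable _ _ _ (fun v => T u - N v * (D v)^-1)); last first.
  exact: (differentiableB (differentiable_cst (T u) u) dND).
have nD : \forall v \near u, D v != 0 by exact: (cvgr_neq0 _ cD).
have nW : \forall v \near u, W v by exact: open_nbhs_nbhs.
near=> v.
have Dv : D v != 0 by near: v.
have : F v (T v) = 0 by apply: FT; near: v.
have -> : F v (T v) = N v + D v * (T v - T u).
  rewrite /N /D /F -[in LHS](subrK (p (T u)) (p (T v))).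
  by rewrite -[in LHS](subrK (q (T u)) (q (T v))) Pp Qq; ring.
move/eqP; rewrite addr_eq0 => /eqP ->.
by rewrite mulNr opprK mulrAC divff // mul1r addrC subrK.
Unshelve. all: by end_near. Qed.

(** Differentiating the equation expresses the derivatives of [T] through
    derivatives of the data and [T] itself, so one more order of smoothness is
    gained at each step. *)
Lemma implicit_Ck (W : set V) (T : V -> R) n : open W ->
  smooth_on W a -> smooth_on W b -> smooth_on W c ->
  (forall u, W u -> [/\ F u (T u) = 0, Ft u (T u) != 0 &
    {for u, continuous T}]) -> Ck n W T.
Proof.
move=> oW sa sb sc TP; elim: n => [|n IH]; first by move=> u /TP[].
have dT u : W u -> differentiable T u.
  move=> Wu; apply: (@implicit_differentiable W) => //.
  - by move=> v /set_mem /TP[].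
  - by move=> v /TP[].
  - by have [] := TP _ Wu.
  - exact: (sa 1%N).1.
  - exact: (sb 1%N).1.
  - exact: (sc 1%N).1.
split=> // v.
have Cc h : smooth_fun h -> Ck n W (fun u => h (T u)).
  by move=> sh; exact: Ck_comp.
have sp' := smooth_fun_derive1 sp.
have sq' := smooth_fun_derive1 sq.
have C1 := CkD oW (CkM oW ((sa n.+1).2 v) (Cc _ sp))
  (CkM oW ((sb n.+1).2 v) (Cc _ sq)).
have C2 := CkD oW C1 ((sc n.+1).2 v).
have C3 := CkD oW (CkM oW (sa n) (Cc _ sp')) (CkM oW (sb n) (Cc _ sq')).
have C3n u : W u -> a u * derive1 p (T u) + b u * derive1 q (T u) != 0.
  by move=> /TP[].
have C4 := CkN oW (CkM oW C2 (CkV oW C3n C3)).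
apply: (Ck_eq oW) C4 => u Wu.
have Da := derivableP (diff_derivable (v := v) ((sa 1%N).1 u Wu)).
have Db := derivableP (diff_derivable (v := v) ((sb 1%N).1 u Wu)).
have Dc := derivableP (diff_derivable (v := v) ((sc 1%N).1 u Wu)).
have Dh h : smooth_fun h ->
    is_derive u v (fun u => h (T u)) (derive1 h (T u) * 'D_v T u).
  move=> sh.
  have dh : differentiable h (T u) by apply/derivable1_diffP; exact: (sh 0%N).
  have dc : differentiable (h \o T) u by apply: differentiable_comp => //; exact: dT.
  have -> : derive1 h (T u) * 'D_v T u = 'D_v (h \o T) u.
    rewrite [RHS]deriveE // (diff_comp (dT u Wu) dh) /= deriveE; last exact: dT.
    by rewrite derive1E' // -[in RHS](mulr1 ('d T u v)) [RHS]linearZ /= mulrC.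
  by apply: derivableP; apply: diff_derivable.
have D0 := is_deriveD (is_deriveD (is_deriveM Da (Dh _ sp))
  (is_deriveM Db (Dh _ sq))) Dc.
have F0 : \forall w \near u, a w * p (T w) + b w * q (T w) + c w = 0.
  by apply: filterS (open_nbhs_nbhs (conj oW Wu)) => w /TP[].
have D1 := near_eq_is_derive F0 D0.
have [_] := D1; rewrite derive_cst /GRing.scale /= => E.
apply: (mulIf (C3n u Wu)); rewrite mulNr divfK ?C3n //.
apply/eqP; rewrite eq_sym -addr_eq0 [X in _ == X]E; apply/eqP; ring.
Qed.
End implicit_function.

Lemma smooth_on_continuous (R : realType) (V W : normedModType R) (U : set V)
  (f : V -> W) : smooth_on U f -> {in U, continuous f}.
Proof. by move=> sf x /set_mem Ux; exact: (sf 0%N). Qed.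

(** A transversal intersection point of a line and a smooth plane curve depends
    smoothly on the line. It serves both for the points where a secant crosses
    the oval, and for the point of the hodograph [g'] with given direction. *)
Lemma implicit_smooth (R : realType) (V : normedModType R) (u0 : V) (t0 : R)
    (a b c : V -> R) (p q : R -> R) :
  smooth_near u0 a -> smooth_near u0 b -> smooth_near u0 c ->
  smooth_fun p -> smooth_fun q ->
  a u0 * p t0 + b u0 * q t0 + c u0 = 0 ->
  a u0 * derive1 p t0 + b u0 * derive1 q t0 != 0 ->
  exists T : V -> R, [/\ T u0 = t0, smooth_near u0 T &
    \forall u \near u0, a u * p (T u) + b u * q (T u) + c u = 0].
Proof.
move=> /smooth_nearP[A [oA Au sa]] /smooth_nearP[B [oB Bu sb]].
move=> /smooth_nearP[C [oC Cu sc]] sp sq F0.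
pose U := A `&` B `&` C.
have oU : open U by apply: openI => //; exact: openI.
have Uu : U u0 by [].
have {}sa : smooth_on U a by move=> n; apply: Ck_sub (sa n) => x [[]].
have {}sb : smooth_on U b by move=> n; apply: Ck_sub (sb n) => x [[]].
have {}sc : smooth_on U c by move=> n; apply: Ck_sub (sc n) => x [].
(* Negating the equation of the line makes the crossing an increasing one. *)
wlog Fpos : a b c sa sb sc F0 / 0 < a u0 * derive1 p t0 + b u0 * derive1 q t0.
  move=> H; rewrite neq_lt => /orP[Fneg|Fpos]; last by apply: H; rewrite ?gt_eqF.
  have [||||||T [T0 sT FT]] := H (fun u => - a u) (fun u => - b u) (fun u => - c u).
  - by move=> n; exact: CkN.
  - by move=> n; exact: CkN.
  - by move=> n; exact: CkN.
  - by rewrite !mulNr -!opprD F0 oppr0.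
  - by rewrite !mulNr -opprD oppr_gt0.
  - by rewrite !mulNr -opprD oppr_eq0 lt_eqF.
  exists T; split=> //; apply: filterS FT => u.
  by rewrite !mulNr -!opprD => /eqP; rewrite oppr_eq0 => /eqP.
move=> _.
have [W [T [oW Wu WU T0 TP]]] := implicit_continuous sp sq oU Uu
  (smooth_on_continuous sa) (smooth_on_continuous sb)
  (smooth_on_continuous sc) F0 Fpos.
exists T; split=> //.
  apply/smooth_nearP; exists W; split=> // n.
  by apply: (implicit_Ck sp sq) TP => // m; apply: Ck_sub WU _.
by apply: filterS (open_nbhs_nbhs (conj oW Wu)) => u /TP[].
Qed.

Section smooth_near_calculus.
Context {R : realType} {V : normedModType R}.
Implicit Types (f g : V -> R) (x : V).

Lemma smooth_near_continuous (W : normedModType R) (f : V -> W) x :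
  smooth_near x f -> {for x, continuous f}.
Proof. by move=> /nbhs_singleton sf; exact: (sf 0%N). Qed.

Lemma smooth_near_eq (W : normedModType R) (f g : V -> W) x :
  (\forall y \near x, f y = g y) -> smooth_near x f -> smooth_near x g.
Proof.
move=> fg /smooth_nearP[U [oU Ux sU]]; apply/smooth_nearP.
have fgi := nbhs_interior fg.
exists (U `&` interior [set y | f y = g y]); split.
- by apply: openI => //; exact: open_interior.
- by split=> //; exact: nbhs_singleton fgi.
move=> n; apply: (@Ck_eq _ _ _ _ f).
- by apply: openI => //; exact: open_interior.
- by move=> y [_ /interior_subset].
- by apply: Ck_sub (sU n) => y [].
Qed.

Lemma smooth_near_cst (W : normedModType R) (k : W) x :
  smooth_near x (fun=> k).
Proof. by apply: nearW => y n; exact: Ck_cst. Qed.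

(** Common lifting of the C^n rules: shrink to an intersection of open
    neighbourhoods. *)
Lemma smooth_near2 (W1 W2 W3 : normedModType R) (f : V -> W1) (g : V -> W2)
    (h : V -> W3) x :
  (forall n U, open U -> Ck n U f -> Ck n U g -> Ck n U h) ->
  smooth_near x f -> smooth_near x g -> smooth_near x h.
Proof.
move=> H /smooth_nearP[U [oU Ux sU]] /smooth_nearP[U' [oU' U'x sU']].
apply/smooth_nearP; exists (U `&` U'); split=> //; first exact: openI.
move=> n; apply: H; first exact: openI.
- by apply: Ck_sub (sU n) => y [].
- by apply: Ck_sub (sU' n) => y [].
Qed.

Lemma smooth_nearD f g x : smooth_near x f -> smooth_near x g ->
  smooth_near x (fun y => f y + g y).
Proof. by apply: smooth_near2 => n U; exact: CkD. Qed.

Lemma smooth_nearM f g x : smooth_near x f -> smooth_near x g ->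
  smooth_near x (fun y => f y * g y).
Proof. by apply: smooth_near2 => n U; exact: CkM. Qed.

Lemma smooth_nearN f x : smooth_near x f -> smooth_near x (fun y => - f y).
Proof.
by move=> sf; apply: (smooth_near2 _ sf sf) => n U oU ? _; exact: CkN.
Qed.

Lemma smooth_nearB f g x : smooth_near x f -> smooth_near x g ->
  smooth_near x (fun y => f y - g y).
Proof. by move=> sf sg; exact: smooth_nearD sf (smooth_nearN sg). Qed.

Lemma smooth_near_comp (h : R -> R) f x : smooth_fun h -> smooth_near x f ->
  smooth_near x (fun y => h (f y)).
Proof.
by move=> sh sf; apply: (smooth_near2 _ sf sf) => n U oU ? _; exact: Ck_comp.
Qed.

Lemma smooth_nearV f x : f x != 0 -> smooth_near x f ->
  smooth_near x (fun y => (f y)^-1).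
Proof.
move=> fx sf; have /nbhs_interior f0 : \forall y \near x, f y != 0.
  exact: (cvgr_neq0 _ (smooth_near_continuous sf) fx).
move: sf => /smooth_nearP[U [oU Ux sU]].
apply/smooth_nearP; exists (U `&` interior [set y | f y != 0]).
have oI : open (U `&` interior [set y | f y != 0]).
  by apply: openI => //; exact: open_interior.
split=> //; first by split=> //; exact: nbhs_singleton f0.
move=> n; apply: CkV => //; first by move=> y [_ /interior_subset].
by apply: Ck_sub (sU n) => y [].
Qed.

Lemma smooth_near_row m (f : V -> 'rV[R]_m) x :
  (forall j, smooth_near x (fun y => f y 0 j)) -> smooth_near x f.
Proof.
move=> sf.
have /nbhs_interior sn : \forall y \near x,
    forall j, smooth_on [set y] (fun y => f y 0 j).
  by apply: filter_forall => j; exact: sf.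
apply/smooth_nearP.
exists (interior [set y | forall j, smooth_on [set y] (fun y => f y 0 j)]).
split; [exact: open_interior|exact: nbhs_singleton sn|].
move=> n; apply: Ck_row; first exact: open_interior.
by move=> j; apply: Ck_pointwise => y /interior_subset; exact.
Qed.

Lemma smooth_near_entry m (f : V -> 'rV[R]_m.+1) x j :
  smooth_near x f -> smooth_near x (fun y => f y 0 j).
Proof.
by move=> sf; apply: (smooth_near2 _ sf sf) => n U oU ? _; exact: Ck_entry.
Qed.

End smooth_near_calculus.

Lemma smooth_near_coord (R : realType) m (x : 'rV[R]_m.+1) j :
  smooth_near x (fun u : 'rV[R]_m.+1 => u 0 j).
Proof. by apply: filterE => y n; exact: Ck_coord. Qed.

(** * Parallel tangents of an oval *)
Section plane.
Context {R : realType}.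
Implicit Types (u v x y z : 'rV[R]_2) (C : set 'rV[R]_2).
Implicit Types g h : R -> 'rV[R]_2.

Lemma row2P u v : u 0 0 = v 0 0 -> u 0 1 = v 0 1 -> u = v.
Proof.
move=> e0 e1; apply/rowP => -[[|[|//]] Hi].
  by rewrite (_ : Ordinal Hi = 0) //; exact: val_inj.
by rewrite (_ : Ordinal Hi = 1) //; exact: val_inj.
Qed.

Lemma det2_eq0_parallel u v : u != 0 -> det2 u v = 0 -> exists k, v = k *: u.
Proof.
rewrite /det2 => u0 /eqP; rewrite subr_eq0 => /eqP d.
have [e0|n0] := eqVneq (u 0 0) 0.
  have n1 : u 0 1 != 0.
    by apply: contraNneq u0 => e1; apply/eqP/row2P; rewrite ?e0 ?e1 mxE.
  exists (v 0 1 / u 0 1); apply: row2P; rewrite mxE; last by rewrite divfK.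
  apply: (mulfI n1); rewrite -d e0; ring.
exists (v 0 0 / u 0 0); apply: row2P; rewrite mxE; first by rewrite divfK.
by apply: (mulfI n0); rewrite d; field.
Qed.

Lemma det2Zl k u v : det2 (k *: u) v = k * det2 u v.
Proof. by rewrite /det2 !mxE; ring. Qed.

Lemma det2Zr k u v : det2 u (k *: v) = k * det2 u v.
Proof. by rewrite /det2 !mxE; ring. Qed.

Lemma det2vv v : det2 v v = 0.
Proof. by rewrite /det2; ring. Qed.

Lemma det2C u v : det2 u v = - det2 v u.
Proof. by rewrite /det2; ring. Qed.

Definition smooth_curve g := forall n t, derivable (derive1n n g) t 1.

Lemma smooth_curve_derive1 g : smooth_curve g -> smooth_curve (derive1 g).
Proof. by move=> sg n t; rewrite -derive1Sn; exact: sg. Qed.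

Lemma derive1_coord g t j : derivable g t 1 ->
  derive1 (fun s => g s 0 j) t = derive1 g t 0 j.
Proof. by move=> dg; rewrite !derive1E derive_mx // mxE. Qed.

Lemma smooth_curve_coord g j : smooth_curve g -> smooth_fun (fun s => g s 0 j).
Proof.
move=> sg n t; rewrite (_ : derive1n n _ = fun s => derive1n n g s 0 j).
  by have /derivable_mxP := sg n t; exact.
elim: n => [//|n IH]; rewrite derive1nS IH; apply/funext => s.
by rewrite derive1_coord //; exact: sg.
Qed.

Lemma is_derive_det2 g v x t : derivable g t 1 ->
  is_derive t (1 : R) (fun s => det2 v (g s - x)) (det2 v (derive1 g t)).
Proof.
move=> dg; have D j : is_derive t (1 : R) (fun s => g s 0 j) (derive1 g t 0 j).
  rewrite -derive1_coord // derive1E; apply: derivableP.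
  by have /derivable_mxP := dg; exact.
have Z (k : R) i : is_derive t (1 : R) (fun s => k * g s 0 i) (k * derive1 g t 0 i).
  exact: is_deriveZ.
have E : (fun s => det2 v (g s - x)) =
  (fun s => v 0 0 * g s 0 1 - v 0 1 * g s 0 0 - det2 v x).
  by apply/funext => s; rewrite /det2 !mxE; ring.
rewrite E.
have := is_deriveB (is_deriveB (Z (v 0 0) 1) (Z (v 0 1) 0))
  (is_derive_cst (det2 v x) t (1 : R)).
by move=> D'; apply: is_derive_eq D' _; rewrite /det2 subr0.
Qed.

(** The critical point equation for the height [det2 v (_ - x)] above the line
    through [x] directed by [v]. *)
Lemma tangent_at_farthest g v x t : smooth_curve g ->
  (forall s, det2 v (g s - x) <= det2 v (g t - x)) -> det2 v (derive1 g t) = 0.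
Proof.
move=> sg tmax.
have dg s : is_derive s (1 : R) (fun s => det2 v (g s - x)) (det2 v (derive1 g s)).
  by apply: is_derive_det2; exact: (sg 0%N).
have D : is_derive t (1 : R) (fun s => det2 v (g s - x)) 0.
  apply: (@derive1_at_max _ _ (t - 1) (t + 1)).
  - by lra.
  - by move=> s _; have [] := dg s.
  - by rewrite in_itv /= ltrBlDr !ltrDl ltr01.
  - by move=> s _; exact: tmax.
by have [_ <-] := dg t; have [_] := D.
Qed.

(** [tangent_dir] quantifies over all parametrizations of [C], but they all have
    the same tangents: the height above the tangent line of [g] at [g t] has an
    extremum at [g t], hence is critical there along any other one too. *)
Lemma tangent_dirE C g t : closed_param g C -> strictly_convex g ->
  tangent_dir C (g t) = [set v | exists k, v = k *: derive1 g t].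
Proof.
move=> cg gc; apply/seteqP; split=> v /=; last by move=> [k ->]; exists g, t, k.
move=> [h [s [k [[sh _ _ _ rh] hs ->]]]].
have [_ g'0 _ _ rg] := cg.
suff d : det2 (derive1 g t) (derive1 h s) = 0.
  have [k' ->] := det2_eq0_parallel (g'0 t) d.
  by exists (k * k'); rewrite scalerA.
have hg r : exists s', h r = g s'.
  have : C (h r) by rewrite -rh; exists r.
  by rewrite -rg => -[s' _ <-]; exists s'.
have [gt|gt] := gc t.
  apply/eqP; rewrite -oppr_eq0 -mulN1r -det2Zl; apply/eqP.
  apply: (@tangent_at_farthest _ _ (g t)) => // r.
  rewrite hs subrr !det2Zl [X in _ <= _ * X](_ : _ = 0); last first.
    by rewrite /det2 !mxE; ring.
  have [s' ->] := hg r; rewrite mulr0 mulN1r oppr_le0.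
  have [->|/gt/ltW//] := eqVneq (g s') (g t).
  by rewrite /det2 !mxE le_eqVlt; apply/orP; left; apply/eqP; ring.
apply: (@tangent_at_farthest _ _ (g t)) => // r.
rewrite hs subrr [X in _ <= X](_ : _ = 0); last by rewrite /det2 !mxE; ring.
have [s' ->] := hg r.
have [->|/gt/ltW//] := eqVneq (g s') (g t).
by rewrite /det2 !mxE le_eqVlt; apply/orP; left; apply/eqP; ring.
Qed.

Lemma tangent_dir_parallel C g s t : closed_param g C -> strictly_convex g ->
  tangent_dir C (g s) = tangent_dir C (g t) <->
  det2 (derive1 g t) (derive1 g s) = 0.
Proof.
move=> cg gc; rewrite !(tangent_dirE _ cg gc).
have [_ g'0 _ _ _] := cg.
split=> [e|d].
  have : [set v | exists k, v = k *: derive1 g s] (derive1 g s).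
    by exists 1; rewrite scale1r.
  by rewrite e => -[k ->]; rewrite det2Zr det2vv mulr0.
have [k e] := det2_eq0_parallel (g'0 t) d.
have k0 : k != 0.
  by apply: contra_neq (g'0 s) => k0; rewrite e k0 scale0r.
apply/seteqP; split=> v /= [k' ->]; first by exists (k' * k); rewrite e scalerA.
by exists (k' / k); rewrite e scalerA divfK.
Qed.

Lemma det2B0 v x : det2 v (x - x) = 0.
Proof. by rewrite subrr /det2 !mxE; ring. Qed.

(** Three parallel tangent lines cannot touch an oval at distinct points, for
    the middle line would leave points of contact on both of its sides. *)
Lemma parallel_tangents_le2 C g r s t : closed_param g C -> strictly_convex g ->
  det2 (derive1 g r) (derive1 g s) = 0 ->
  det2 (derive1 g r) (derive1 g t) = 0 ->
  g r != g s -> g r != g t -> g s = g t.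
Proof.
move=> cg gc drs drt rs rt; apply/eqP/negPn/negP => st.
have [_ g'0 _ _ _] := cg.
have sup q : det2 (derive1 g r) (derive1 g q) = 0 ->
    (forall q', g q' != g q -> 0 < det2 (derive1 g r) (g q' - g q)) \/
    (forall q', g q' != g q -> det2 (derive1 g r) (g q' - g q) < 0).
  move=> d; have := d; rewrite det2C => /eqP; rewrite oppr_eq0 => /eqP d'.
  have [k e] := det2_eq0_parallel (g'0 q) d'; rewrite e.
  have [k0|k0|k0] := ltgtP k 0; last first.
  - by have := g'0 r; rewrite e k0 scale0r eqxx.
  - by have [H|H] := gc q; [left|right] => q' /H; rewrite det2Zl;
      [rewrite pmulr_rgt0|rewrite pmulr_rlt0].
  - by have [H|H] := gc q; [right|left] => q' /H; rewrite det2Zl;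
      [rewrite nmulr_rlt0|rewrite nmulr_rgt0].
have sr : g s != g r by rewrite eq_sym.
have tr : g t != g r by rewrite eq_sym.
have ts : g t != g s by rewrite eq_sym.
have dB y z : det2 (derive1 g r) (z - y) =
    det2 (derive1 g r) z - det2 (derive1 g r) y.
  by rewrite /det2 !mxE; ring.
pose height q := det2 (derive1 g r) (g q).
have sup2 q m n : det2 (derive1 g r) (derive1 g q) = 0 ->
    g m != g q -> g n != g q ->
    (height q < height m /\ height q < height n) \/
    (height m < height q /\ height n < height q).
  move=> /sup[H|H] mq nq; [left|right].
    by have := H _ mq; have := H _ nq; rewrite !dB !subr_gt0.
  by have := H _ mq; have := H _ nq; rewrite !dB !subr_lt0.
(* None of the three distinct heights can lie between the other two. *)
have := sup2 _ _ _ (det2vv _) sr tr; have := sup2 _ _ _ drs rs ts.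
have := sup2 _ _ _ drt rt st.
move: (height r) (height s) (height t) => a b c.
by move=> [[h1 h2]|[h1 h2]] [[h3 h4]|[h3 h4]] [[h5 h6]|[h5 h6]];
  have := lt_asym a b; have := lt_asym b c; have := lt_asym a c;
  rewrite ?h1 ?h2 ?h3 ?h4 ?h5 ?h6.
Qed.

(** By periodicity; this reduces extrema over the line to a compact interval. *)
Lemma closed_param_unit g C t : closed_param g C ->
  exists2 s, s \in `[0, 1]%R & g s = g t.
Proof.
move=> [_ _ per _ _].
have perN n s : g (s + n%:R) = g s.
  by elim: n => [|n IH]; rewrite ?addr0 // -natr1 addrA per.
have perZ (k : int) s : g (s + k%:~R) = g s.
  case: k => n; first exact: perN.
  by rewrite NegzE mulrNz -{2}[s](subrK n.+1%:R) perN.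
exists (t - (Num.floor t)%:~R).
  have /andP[h1 h2] := Num.Theory.floor_itv t.
  by rewrite in_itv /= subr_ge0 h1 /= lerBlDl ltW //; move: h2; rewrite intrD.
by rewrite -[in RHS](subrK (Num.floor t)%:~R t) perZ.
Qed.

Lemma farthest_point g C v x : closed_param g C ->
  exists c, forall s, det2 v (g s - x) <= det2 v (g c - x).
Proof.
move=> cg; have [sg _ _ _ _] := cg.
have [|c _ cmax] := @EVT_max _ (fun s => det2 v (g s - x)) 0 1 ler01.
  apply: derivable_within_continuous => t _.
  by have [] := @is_derive_det2 g v x t (sg 0%N t).
by exists c => s; have [s' s'01 <-] := closed_param_unit s cg; exact: cmax.
Qed.

Lemma exists_other_point g C x : closed_param g C -> exists s, g s != x.
Proof.
move=> [_ _ _ inj _]; have [e|] := eqVneq (g 0) x; last by exists 0.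
exists 2^-1; rewrite -e; apply/eqP => /inj H.
have : (2^-1 : R) = 0.
  by apply: H; rewrite inE /= in_itv /= ?lexx ?ltr01 //;
    rewrite invr_ge0 ler0n invf_lt1 // ltr1n.
by apply/eqP; rewrite invr_eq0 pnatr_eq0.
Qed.

(** The point farthest from the tangent line at [g t] has a parallel tangent,
    and lies off that line, so it differs from [g t]. *)
Lemma exists_parallel g C t : closed_param g C -> strictly_convex g ->
  exists s, g s != g t /\ det2 (derive1 g t) (derive1 g s) = 0.
Proof.
move=> cg gc; have [sg _ _ _ _] := cg.
have [q qt] := exists_other_point (g t) cg.
have [H|H] := gc t.
  have [c cmax] := farthest_point (derive1 g t) (g t) cg.
  exists c; split; last exact: tangent_at_farthest cmax.
  apply: contraTneq (H q qt) => e.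
  by rewrite -leNgt; have := cmax q; rewrite e det2B0.
(* Here the heights are negative, and the lowest point is the farthest. *)
have [c cmax] := farthest_point (-1 *: derive1 g t) (g t) cg.
exists c; split; last first.
  have := tangent_at_farthest sg cmax; rewrite det2Zl mulN1r => /eqP.
  by rewrite oppr_eq0 => /eqP.
apply: contraTneq (H q qt) => e; rewrite -leNgt.
by have := cmax q; rewrite e det2B0 det2Zl mulN1r oppr_le0.
Qed.

Lemma iotaC_param g C t s : closed_param g C -> strictly_convex g ->
  g s != g t -> det2 (derive1 g t) (derive1 g s) = 0 -> iotaC C (g t) = g s.
Proof.
move=> cg gc st d; have [_ _ _ _ rg] := cg.
rewrite /iotaC; case: xgetP => [y _ [Cy yt /esym e]|/(_ (g s)) []].
  move: Cy; rewrite -rg => -[r _ ?]; subst y.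
  move: e => /esym /(tangent_dir_parallel _ _ cg gc) d'.
  by apply: (parallel_tangents_le2 cg gc d' d); rewrite eq_sym.
split=> //; first by rewrite -rg; exists s.
exact/(tangent_dir_parallel _ _ cg gc).
Qed.

Lemma iotaC_unique C x y : oval C -> C x -> C y -> y != x ->
  tangent_dir C y = tangent_dir C x -> iotaC C x = y.
Proof.
move=> [g [cg gc _]]; have [_ _ _ _ rg] := cg.
rewrite -{1 2}rg => -[t _ <-] [s _ <-] st /(tangent_dir_parallel _ _ cg gc) d.
exact: iotaC_param cg gc st d.
Qed.

Lemma iotaCP C x : oval C -> C x ->
  [/\ C (iotaC C x), iotaC C x != x & tangent_dir C (iotaC C x) = tangent_dir C x].
Proof.
move=> [g [cg gc _]]; have [_ _ _ _ rg] := cg.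
rewrite -{1}rg => -[t _ <-].
have [s [st d]] := exists_parallel t cg gc.
rewrite (iotaC_param cg gc st d); split=> //; first by rewrite -rg; exists s.
exact/(tangent_dir_parallel _ _ cg gc).
Qed.

Lemma iotaCK C x : oval C -> C x -> iotaC C (iotaC C x) = x.
Proof.
move=> oC Cx; have [Ci ix e] := iotaCP oC Cx.
by apply: iotaC_unique => //; rewrite eq_sym.
Qed.

End plane.

(** * The reflection on secants *)
Section reflection.
Context {R : realType}.
Implicit Types (u x y p : 'rV[R]_2) (C : set 'rV[R]_2) (g : R -> 'rV[R]_2).
Implicit Types l : line R.

Lemma join_inj C x y x' y' : oval C -> C x -> C y -> C x' -> C y' ->
  x != y -> x' != y' -> join x y = join x' y' ->
  (x' = x /\ y' = y) \/ (x' = y /\ y' = x).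
Proof.
move=> oC Cx Cy Cx' Cy' xy xy' e.
have := points_join_oval oC Cx Cy xy; rewrite e.
rewrite (points_join_oval oC Cx' Cy' xy') => s.
have : [set x; y] x' by rewrite -s; left.
have : [set x; y] y' by rewrite -s; right.
move=> /= [ey|ey] [ex|ex]; [|by right|by left|];
  by rewrite ex ey eqxx in xy'.
Qed.

Lemma iotaC_neq C x y : oval C -> C x -> C y -> x != y -> iotaC C x != iotaC C y.
Proof.
move=> oC Cx Cy; apply: contra_neq => e.
by rewrite -(iotaCK oC Cx) e iotaCK.
Qed.

Lemma secant_reflection C l : oval C -> secant C l ->
  secant C (affine_reflection C l).
Proof.
move=> oC /(secantE _ oC)[x [y [Cx Cy xy ->]]]; rewrite affine_reflection_join //.
apply/(secantE _ oC); exists (iotaC C x), (iotaC C y); split=> //.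
- by have [] := iotaCP oC Cx.
- by have [] := iotaCP oC Cy.
- exact: iotaC_neq.
Qed.

Lemma reflectionK C l : oval C -> secant C l ->
  affine_reflection C (affine_reflection C l) = l.
Proof.
move=> oC /(secantE _ oC)[x [y [Cx Cy xy ->]]]; rewrite affine_reflection_join //.
have [Cix _ _] := iotaCP oC Cx; have [Ciy _ _] := iotaCP oC Cy.
by rewrite affine_reflection_join ?iotaC_neq // !iotaCK.
Qed.

Lemma reflection_fixed C : oval C ->
  [set l | secant C l /\ affine_reflection C l = l] =
    [set join x (iotaC C x) | x in C].
Proof.
move=> oC; apply/seteqP; split=> l /=.
  move=> [/(secantE _ oC)[x [y [Cx Cy xy ->]]]].
  rewrite affine_reflection_join // => e.
  have [Cix ix _] := iotaCP oC Cx; have [Ciy iy _] := iotaCP oC Cy.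
  have ixy := iotaC_neq oC Cx Cy xy.
  have [[ex _]|[ex _]] := join_inj oC Cx Cy Cix Ciy xy ixy (esym e).
    by rewrite ex eqxx in ix.
  by exists x => //; rewrite ex.
move=> [x Cx <-].
have [Cix ix _] := iotaCP oC Cx.
have xi : x != iotaC C x by rewrite eq_sym.
split; first by apply/(secantE _ oC); exists x, (iotaC C x).
by rewrite affine_reflection_join // iotaCK // Defs.joinC.
Qed.

End reflection.

(** * Smooth dependence of chords on their line *)
Section local_form.
Context {R : realType}.
Implicit Types (u x y p : 'rV[R]_2) (C : set 'rV[R]_2) (g : R -> 'rV[R]_2).
Implicit Types l : line R.

Lemma curvature_det2 g t : 0 < curvature g t ->
  0 < det2 (derive1 g t) (derive1n 2 g t).
Proof.
rewrite /curvature => k0; rewrite ltNge; apply: contraTN k0 => d0.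
by rewrite -leNgt mulr_le0_ge0 // invr_ge0 exprn_ge0 // sqrtr_ge0.
Qed.

Lemma smooth_near_curve (V : normedModType R) g (T : V -> R) (u0 : V) :
  smooth_curve g -> smooth_near u0 T -> smooth_near u0 (g \o T).
Proof.
move=> sg sT; apply: smooth_near_row => j.
exact: (smooth_near_comp (@smooth_curve_coord _ _ j sg) sT).
Qed.

(** The opposite point is where the hodograph [g'] meets the line through the
    origin directed by [g' (T u)]. Since [g'] is parallel to that line there,
    the crossing is transversal exactly when [det2 g' g''] is nonzero, and
    positive curvature ensures it. The solution stays distinct from [g (T u)]
    by continuity, so it is the opposite point for all nearby [u]. *)
Lemma iotaC_smooth (V : normedModType R) C g (T : V -> R) (u0 : V) :
  closed_param g C -> strictly_convex g -> (forall t, 0 < curvature g t) ->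
  smooth_near u0 T ->
  exists S : V -> R, smooth_near u0 S /\
    \forall u \near u0, iotaC C (g (T u)) = g (S u).
Proof.
move=> cg gc kg sT; have [sg g'0 _ _ _] := cg.
have [s0 [st d]] := exists_parallel (T u0) cg gc.
have sg' := smooth_curve_derive1 sg.
pose p s := derive1 g s 0 0; pose q s := derive1 g s 0 1.
have sp : smooth_fun p := @smooth_curve_coord _ _ 0 sg'.
have sq : smooth_fun q := @smooth_curve_coord _ _ 1 sg'.
have dp s : derive1 p s = derive1n 2 g s 0 0
  by rewrite derive1_coord //; exact: (sg' 0%N).
have dq s : derive1 q s = derive1n 2 g s 0 1
  by rewrite derive1_coord //; exact: (sg' 0%N).
have [||||S [S0 sS FS]] := @implicit_smooth _ _ u0 s0
  (fun b => - q (T b)) (fun b => p (T b)) (fun=> 0) p q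
  _ _ (smooth_near_cst _ _) sp sq.
- exact/smooth_nearN/smooth_near_comp.
- exact: smooth_near_comp.
- by rewrite /= addr0 addrC mulNr; exact: d.
- rewrite dp dq addrC mulNr.
  have d' : det2 (derive1 g s0) (derive1 g (T u0)) = 0 by rewrite det2C d oppr0.
  have [k e] := det2_eq0_parallel (g'0 s0) d'.
  have k0 : k != 0.
    by apply: contra_neq (g'0 (T u0)) => k0; rewrite e k0 scale0r.
  rewrite -[X in X != 0]/(det2 (derive1 g (T u0)) (derive1n 2 g s0)) e det2Zl.
  by rewrite mulf_neq0 // gt_eqF // curvature_det2.
exists S; split=> //.
have cT := smooth_near_continuous (smooth_near_curve sg sT).
have cS := smooth_near_continuous (smooth_near_curve sg sS).
have n0 : \forall u \near u0, g (S u) - g (T u) != 0.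
  have cD : {for u0, continuous (fun b => g (S b) - g (T b))} by exact: cvgB.
  by apply: (cvgr_neq0 _ cD); rewrite S0 subr_eq0.
near=> u.
apply: iotaC_param cg gc _ _; first by rewrite -subr_eq0; near: u; exact: n0.
have : - q (T u) * p (S u) + p (T u) * q (S u) + 0 = 0 by near: u; exact: FS.
by rewrite addr0 addrC mulNr.
Unshelve. all: by end_near. Qed.

Definition unchart_coords (i : 'I_3) u : 'rV[R]_3 :=
  \row_(k < 3) if unlift i k is Some j then u 0 j else 1.

Lemma unchart_coords_neq0 i u : unchart_coords i u != 0.
Proof.
apply/eqP => /rowP/(_ i)/eqP; rewrite !mxE unlift_none.
by rewrite oner_eq0.
Qed.

Lemma smooth_unchart_coords i k u0 :
  smooth_near u0 (fun u => unchart_coords i u 0 k).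
Proof.
rewrite /unchart_coords; case E : (unlift i k) => [j|].
  rewrite (_ : (fun u => _) = fun u : 'rV[R]_2 => u 0 j).
    exact: smooth_near_coord.
  by apply/funext => u; rewrite mxE E.
rewrite (_ : (fun u => _) = fun u : 'rV[R]_2 => 1); first exact: smooth_near_cst.
by apply/funext => u; rewrite mxE E.
Qed.

Lemma points_unchart i u p : points (unchart i u) p <->
  unchart_coords i u 0 0 * p 0 0 + unchart_coords i u 0 1 * p 0 1
    + unchart_coords i u 0 ord_max = 0.
Proof.
by rewrite /unchart points_mkline // -/(unchart_coords i u) unchart_coords_neq0.
Qed.

(** A secant crosses the oval transversally: otherwise it would be the tangent
    line at [g t0], which by strict convexity misses [g s0]. *)
Lemma intersection_smooth C g (i : 'I_3) u0 t0 s0 :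
  closed_param g C -> strictly_convex g -> g t0 != g s0 ->
  unchart i u0 = join (g t0) (g s0) ->
  exists T : 'rV[R]_2 -> R, [/\ T u0 = t0, smooth_near u0 T &
    \forall u \near u0, points (unchart i u) (g (T u))].
Proof.
move=> cg gc ts e; have [sg g'0 _ _ _] := cg.
pose p s := g s 0 0; pose q s := g s 0 1.
have sp : smooth_fun p := @smooth_curve_coord _ _ 0 sg.
have sq : smooth_fun q := @smooth_curve_coord _ _ 1 sg.
have dp s : derive1 p s = derive1 g s 0 0
  by rewrite derive1_coord //; exact: (sg 0%N).
have dq s : derive1 q s = derive1 g s 0 1
  by rewrite derive1_coord //; exact: (sg 0%N).
have Pt : points (unchart i u0) (g t0).
  by rewrite e points_join //= det2B0.
have Ps : points (unchart i u0) (g s0).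
  by rewrite e points_join //= det2vv.
have [||T [T0 sT FT]] := @implicit_smooth _ _ u0 t0 _ _ _ p q
  (smooth_unchart_coords i 0 u0) (smooth_unchart_coords i 1 u0)
  (smooth_unchart_coords i ord_max u0) sp sq.
- exact/points_unchart.
- rewrite dp dq; apply/eqP.
  move: Pt Ps => /points_unchart + /points_unchart.
  have := unchart_coords_neq0 i u0.
  set v := unchart_coords i u0 => v0 Pt Ps D.
  have : det2 (derive1 g t0) (g s0 - g t0) != 0.
    have [H|H] := gc t0; have := H s0; rewrite eq_sym => /(_ ts) HH.
      by rewrite gt_eqF.
    by rewrite lt_eqF.
  apply/negP; rewrite negbK; apply/eqP.
  have Pd : v 0 0 * (g s0 - g t0) 0 0 + v 0 1 * (g s0 - g t0) 0 1 = 0.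
    rewrite (_ : _ + _ =
      (v 0 0 * g s0 0 0 + v 0 1 * g s0 0 1 + v 0 ord_max) -
      (v 0 0 * g t0 0 0 + v 0 1 * g t0 0 1 + v 0 ord_max)).
      by rewrite Ps Pt subrr.
    by rewrite !mxE; ring.
  move: D Pd; set a := derive1 g t0; set b := g s0 - g t0 => D Pd.
  (* The normal [(v 0 0, v 0 1)] annihilates the velocity [a] and the chord [b]
     alike; by Cramer's rule it vanishes unless they are parallel. *)
  have E0 : v 0 0 * det2 a b = 0.
    rewrite (_ : _ * _ = (v 0 0 * a 0 0 + v 0 1 * a 0 1) * b 0 1
      - (v 0 0 * b 0 0 + v 0 1 * b 0 1) * a 0 1); last by rewrite /det2; ring.
    by rewrite D Pd !mul0r subrr.
  have E1 : v 0 1 * det2 a b = 0.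
    rewrite (_ : _ * _ = (v 0 0 * b 0 0 + v 0 1 * b 0 1) * a 0 0
      - (v 0 0 * a 0 0 + v 0 1 * a 0 1) * b 0 0); last by rewrite /det2; ring.
    by rewrite D Pd !mul0r subrr.
  apply/eqP; apply: contraNT v0 => d0.
  have v00 : v 0 0 = 0 by apply/eqP; move/eqP: E0; rewrite mulf_eq0 (negPf d0) orbF.
  have v01 : v 0 1 = 0 by apply/eqP; move/eqP: E1; rewrite mulf_eq0 (negPf d0) orbF.
  have v02 : v 0 ord_max = 0 by rewrite -Pt v00 v01; ring.
  apply/eqP/rowP => -[[|[|[|//]]] Hi]; rewrite [RHS]mxE.
  + by rewrite -v00; congr (v 0 _); exact: val_inj.
  + by rewrite -v01; congr (v 0 _); exact: val_inj.
  + by rewrite -v02; congr (v 0 _); exact: val_inj.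
by exists T; split=> //; apply: filterS FT => u Fu; apply/points_unchart.
Qed.

(** In a chart, both end points of a chord and both opposite points are smooth
    functions of the line. Since every line near a secant is again a secant by
    this construction, the openness of the set of secants follows as well. *)
Lemma local_form C (i : 'I_3) u0 : oval C -> secant C (unchart i u0) ->
  exists P1 P2 Q1 Q2 : 'rV[R]_2 -> 'rV[R]_2,
  [/\ [/\ smooth_near u0 P1, smooth_near u0 P2, smooth_near u0 Q1 &
         smooth_near u0 Q2],
    \forall u \near u0, [/\ C (P1 u), C (P2 u), P1 u != P2 u &
      unchart i u = join (P1 u) (P2 u)] &
    \forall u \near u0, Q1 u = iotaC C (P1 u) /\ Q2 u = iotaC C (P2 u)].
Proof.
move=> oC /(secantE _ oC)[x [y [Cx Cy xy e]]].
have [g [cg gc kg]] := oC; have [sg _ _ _ rg] := cg.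
move: (Cx) (Cy); rewrite -{1 2}rg => -[t0 _ xt] [s0 _ ys].
rewrite -xt -ys in e xy.
have [T1 [T10 sT1 pT1]] := intersection_smooth cg gc xy e.
have [|T2 [T20 sT2 pT2]] := @intersection_smooth _ _ i u0 s0 t0 cg gc _
  (etrans e (Defs.joinC _ _)).
  by rewrite eq_sym.
have [S1 [sS1 iS1]] := iotaC_smooth cg gc kg sT1.
have [S2 [sS2 iS2]] := iotaC_smooth cg gc kg sT2.
exists (g \o T1), (g \o T2), (g \o S1), (g \o S2); split.
- by split; exact: smooth_near_curve.
- have cT1 := smooth_near_continuous (smooth_near_curve sg sT1).
  have cT2 := smooth_near_continuous (smooth_near_curve sg sT2).
  have n0 : \forall u \near u0, g (T1 u) - g (T2 u) != 0.
    have cD : {for u0, continuous (fun u => g (T1 u) - g (T2 u))}.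
      exact: (cvgB cT1 cT2).
    by apply: (cvgr_neq0 _ cD); rewrite T10 T20 subr_eq0.
  near=> u.
  have n : g (T1 u) != g (T2 u) by rewrite -subr_eq0; near: u; exact: n0.
  split=> //=; [by rewrite -rg; exists (T1 u)|by rewrite -rg; exists (T2 u)|].
  by apply: join_unique => //; [near: u; exact: pT1|near: u; exact: pT2].
- by near=> u => /=; split; apply/esym; near: u; [exact: iS1|exact: iS2].
Unshelve. all: by end_near. Qed.
End local_form.

(** * The charts of the plane of lines *)
Section topology_lines.
Context {R : realType}.
Implicit Types (l : line R).

(** On nonzero vectors [mkline] is the projection to the quotient after the
    section of [nzval], which is continuous for the initial topology. *)
Lemma mkline_continuous (v0 : 'rV[R]_3) : v0 != 0 ->
  {for v0, continuous (@mkline R)}.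
Proof.
move=> v00; pose d := NzVec (infinity_neq0 R).
apply: (@continuous_comp _ _ _ (insubd d) (\pi_(line R))%qT); last first.
  exact: pi_continuous.
move=> A /=; rewrite nbhsE => -[B [[U oU OB] Bv] BA].
have v0K : nzval (insubd d v0) = v0 by exact: insubdK.
have nO : \forall v \near v0, U v.
  apply: open_nbhs_nbhs; split=> //; rewrite -v0K.
  by rewrite -OB in Bv.
have nv : \forall v \near v0, v != 0 by exact: (cvgr_neq0 _ (@cvg_id _ (nbhs v0))).
change (\forall v \near v0, A (insubd d v)); near=> v.
apply: BA; rewrite -OB /=.
have -> : nzval (insubd d v) = v by apply: insubdK; near: v.
by near: v.
Unshelve. all: by end_near. Qed.

Definition ratios (i : 'I_3) (v : 'rV[R]_3) : 'rV[R]_2 :=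
  \row_(j < 2) (v 0 (lift i j) / v 0 i).

Lemma chart_mkline (i : 'I_3) (v : 'rV[R]_3) : v != 0 ->
  chart i (mkline v) = ratios i v.
Proof.
move=> v0; have [k k0 e] := coords_mkline v0.
apply/rowP => j; rewrite !mxE e !mxE.
by rewrite invfM mulrACA divff // mul1r.
Qed.

Lemma chart_dom_mkline (i : 'I_3) (v : 'rV[R]_3) : v != 0 ->
  chart_dom i (mkline v) = (v 0 i != 0) :> Prop.
Proof.
move=> v0; have [k k0 e] := coords_mkline v0.
by rewrite /chart_dom /= e mxE mulf_eq0 (negPf k0).
Qed.

Lemma smooth_ratios (V : normedModType R) (i : 'I_3) (E : V -> 'rV[R]_3) (x : V) :
  E x 0 i != 0 -> (forall k, smooth_near x (fun y => E y 0 k)) ->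
  smooth_near x (fun y => ratios i (E y)).
Proof.
move=> Ei sE; apply: smooth_near_row => j.
rewrite (_ : (fun y => _) = fun y => E y 0 (lift i j) * (E y 0 i)^-1).
  by apply: smooth_nearM => //; exact: smooth_nearV.
by apply/funext => y; rewrite mxE.
Qed.

(** Openness in the quotient is openness of the set of representing vectors,
    where the chart is given by ratios of coordinates. *)
Lemma open_chart (i : 'I_3) (O : set 'rV[R]_2) : open O ->
  open [set l : line R | chart_dom i l /\ O (chart i l)].
Proof.
move=> oO; pose B := [set v : 'rV[R]_3 | v 0 i != 0 /\ O (ratios i v)].
have oB : open B.
  rewrite openE => v0 [vi Ov].
  have sv := @smooth_ratios _ i id v0 vi (fun k => smooth_near_coord v0 k).
  have nO : \forall v \near v0, O (ratios i v).
    by apply: (smooth_near_continuous sv); exact: open_nbhs_nbhs.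
  have ni : \forall v \near v0, (v : 'rV[R]_3) 0 i != 0.
    by apply: (cvgr_neq0 _ (smooth_near_continuous (smooth_near_coord v0 i))).
  by rewrite /interior; near=> v; split; near: v.
have piE (w : nzvec R) : (\pi_(line R) w)%qT = mkline (nzval w).
  by rewrite /mkline; congr (\pi _)%qT; rewrite valKd.
change (open ((\pi_(line R))%qT @^-1`
  [set l : line R | chart_dom i l /\ O (chart i l)])).
exists B => //; apply/seteqP; split=> w; rewrite /B /=;
  by rewrite piE chart_dom_mkline ?chart_mkline //; exact: nzval_neq0.
Unshelve. all: by end_near. Qed.

Lemma near_chart (i : 'I_3) (l0 : line R) (P : 'rV[R]_2 -> Prop) :
  chart_dom i l0 -> (\forall u \near chart i l0, P u) ->
  \forall l \near l0, chart_dom i l /\ P (chart i l).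
Proof.
move=> li /nbhs_interior nP.
have oC := @open_chart i (interior [set u | P u]) (open_interior _).
have nl : nbhs l0 [set l | chart_dom i l /\ interior [set u | P u] (chart i l)].
  by apply: open_nbhs_nbhs; split=> //; split=> //; exact: nbhs_singleton nP.
by apply: filterS nl => l [? /interior_subset].
Qed.

Lemma exists_chart (l : line R) : exists i, chart_dom i l.
Proof. by have /rV0Pn[i li] := coords_neq0 l; exists i. Qed.

Definition join_coords (x y : 'rV[R]_2) : 'rV[R]_3 :=
  \row_(k < 3) [:: x 0 1 - y 0 1; y 0 0 - x 0 0;
                   x 0 0 * y 0 1 - x 0 1 * y 0 0]`_k.

Lemma smooth_join_coords (V : normedModType R) (P Q : V -> 'rV[R]_2) (x : V) k :
  smooth_near x P -> smooth_near x Q ->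
  smooth_near x (fun y => join_coords (P y) (Q y) 0 k).
Proof.
move=> sP sQ.
case: k => [[|[|[|//]]] Hk].
- rewrite (_ : (fun y => _) = fun y => P y 0 1 - Q y 0 1); last first.
    by apply/funext => y; rewrite mxE.
  by apply: smooth_nearB; exact: smooth_near_entry.
- rewrite (_ : (fun y => _) = fun y => Q y 0 0 - P y 0 0); last first.
    by apply/funext => y; rewrite mxE.
  by apply: smooth_nearB; exact: smooth_near_entry.
- rewrite (_ : (fun y => _) =
      fun y => P y 0 0 * Q y 0 1 - P y 0 1 * Q y 0 0); last first.
    by apply/funext => y; rewrite mxE.
  by apply: smooth_nearB; apply: smooth_nearM; exact: smooth_near_entry.
Qed.

End topology_lines.

(** * The reflection is smooth *)
Section main_parts.
Context {R : realType}.
Implicit Types (C : set 'rV[R]_2) (l : line R).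

Lemma secant_open C : oval C -> open (secant C).
Proof.
move=> oC; rewrite openE => l0 sl; have [i li] := exists_chart l0.
have sl' : secant C (unchart i (chart i l0)) by rewrite chartK.
have [P1 [P2 [Q1 [Q2 [_ nP _]]]]] := local_form oC sl'.
have := near_chart li nP; apply: filterS => l [dl []]; rewrite chartK // => C1 C2 n e.
by apply/(secantE _ oC); exists (P1 (chart i l)), (P2 (chart i l)).
Qed.

(** Homogeneous coordinates of the reflected line that are smooth in the chart;
    both the continuity of the reflection and the smoothness of its chart
    expressions are read off from them. *)
Lemma reflection_local C i u0 : oval C -> secant C (unchart i u0) ->
  exists E : 'rV[R]_2 -> 'rV[R]_3, (forall k, smooth_near u0 (fun u => E u 0 k)) /\
    \forall u \near u0, E u != 0 /\ affine_reflection C (unchart i u) = mkline (E u).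
Proof.
move=> oC su; have [P1 [P2 [Q1 [Q2 [[_ _ s1 s2] nP nQ]]]]] := local_form oC su.
exists (fun u => join_coords (Q1 u) (Q2 u)); split.
  by move=> k; exact: smooth_join_coords.
near=> u.
have [C1 C2 n e] : [/\ C (P1 u), C (P2 u), P1 u != P2 u &
      unchart i u = join (P1 u) (P2 u)] by near: u.
have [e1 e2] : Q1 u = iotaC C (P1 u) /\ Q2 u = iotaC C (P2 u) by near: u.
split; first by apply: join_neq0; rewrite e1 e2 iotaC_neq.
by rewrite e affine_reflection_join // e1 e2.
Unshelve. all: by end_near. Qed.

Lemma reflection_continuous C l0 : oval C -> secant C l0 ->
  {for l0, continuous (affine_reflection C)}.
Proof.
move=> oC sl; have [i li] := exists_chart l0.
have sl' : secant C (unchart i (chart i l0)) by rewrite chartK.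
have [E [sE nE]] := reflection_local oC sl'.
have [E0 EE] := nbhs_singleton nE.
have sE' := smooth_near_row sE.
have E1 : affine_reflection C l0 = mkline (E (chart i l0)) by rewrite -EE chartK.
move=> A; rewrite E1 => nA.
change (\forall l \near l0, A (affine_reflection C l)).
have nE' : \forall u \near chart i l0, A (mkline (E u)).
  exact: (continuous_comp (smooth_near_continuous sE') (mkline_continuous E0)).
have nEE : \forall u \near chart i l0,
    affine_reflection C (unchart i u) = mkline (E u) /\ A (mkline (E u)).
  by apply: filterS2 nE nE' => u [].
apply: filterS (near_chart li nEE) => l [dl []]; rewrite chartK // => e.
by rewrite -e.
Unshelve. all: by end_near. Qed.

Lemma reflection_smooth C : oval C -> smooth_lines (secant C) (affine_reflection C).
Proof.
move=> oC; split.
  by apply: continuous_in_subspaceT => l /set_mem; exact: reflection_continuous.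
move=> i j n; apply: Ck_pointwise => u0 [su dj].
have [E [sE nE]] := reflection_local oC su.
have [E0 EE] := nbhs_singleton nE.
rewrite EE chart_dom_mkline // in dj.
suff /nbhs_singleton : smooth_near u0
  (fun u => chart j (affine_reflection C (unchart i u))) by apply.
apply: smooth_near_eq (smooth_ratios dj sE).
by apply: filterS nE => u [Eu ->]; rewrite chart_mkline.
Qed.

End main_parts.

(** * Affine maps *)
Section affine_equivariance.
Context {R : realType}.
Implicit Types (C : set 'rV[R]_2) (l : line R) (M : 'M[R]_2) (b x y p : 'rV[R]_2).

Lemma affine_map_inv M b : M \in unitmx ->
  cancel (affine_map M b) (affine_map (invmx M) (- (b *m invmx M))).
Proof.
by move=> Mu p; rewrite /affine_map mulmxDl mulmxK // addrK.
Qed.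

(** Entrywise, as a row of [g s *m M] is a linear combination of coordinates. *)
Lemma derive1_mulmx (g : R -> 'rV[R]_2) M t : derivable g t 1 ->
  is_derive t (1 : R) (fun s => g s *m M) (derive1 g t *m M).
Proof.
move=> dg.
have D j : is_derive t (1 : R) (fun s => (g s *m M) 0 j) ((derive1 g t *m M) 0 j).
  have Z i : is_derive t (1 : R)
      (fun s => M i j * g s 0 i) (M i j * derive1 g t 0 i).
    apply: is_deriveZ; rewrite -derive1_coord // derive1E; apply: derivableP.
    by have /derivable_mxP := dg; exact.
  have := is_derive_sum Z.
  rewrite (_ : \sum_(i < 2) (fun s => M i j * g s 0 i) = (fun s => (g s *m M) 0 j)).
    move=> D; apply: is_derive_eq D _; rewrite mxE.
    by apply: eq_bigr => i _; rewrite mulrC.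
  by apply/funext => s; rewrite fct_sumE mxE; apply: eq_bigr => i _; rewrite mulrC.
have dgM : derivable (fun s => g s *m M) t 1.
  by apply/derivable_mxP => i j; rewrite (ord1 i); have [] := D j.
split=> //; rewrite derive_mx //; apply/rowP => j; rewrite mxE.
by have [_ ->] := D j.
Qed.

Lemma closed_param_affine g C M b : M \in unitmx -> closed_param g C ->
  closed_param (affine_map M b \o g) (affine_map M b @` C) /\
  forall t, derive1 (affine_map M b \o g) t = derive1 g t *m M.
Proof.
move=> Mu [sg g'0 per inj rg].
have D t : is_derive t (1 : R) (affine_map M b \o g) (derive1 g t *m M).
  have := is_deriveD (derive1_mulmx M (sg 0%N t)) (is_derive_cst b t (1 : R)).
  by rewrite addr0.
have D1 t : derive1 (affine_map M b \o g) t = derive1 g t *m M.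
  by rewrite derive1E; have [_ ->] := D t.
have Dn n t : derive1n n.+1 (affine_map M b \o g) t = derive1n n.+1 g t *m M.
  elim: n t => [//|n IH] t; rewrite derive1nS.
  have -> : derive1n n.+1 (affine_map M b \o g) = fun s => derive1n n.+1 g s *m M.
    by apply/funext.
  by rewrite derive1E; have [_ ->] := derive1_mulmx M (sg n.+1 t).
split; last exact: D1.
split.
- case=> [|n] t; first by have [] := D t.
  have -> : derive1n n.+1 (affine_map M b \o g) = fun s => derive1n n.+1 g s *m M.
    by apply/funext.
  by have [] := derive1_mulmx M (sg n.+1 t).
- move=> t; rewrite D1; apply: contra_neq (g'0 t) => e.
  by rewrite -[LHS](mulmxK Mu) e mul0mx.
- by move=> t /=; rewrite per.
- by move=> s t s01 t01 /= /(can_inj (affine_map_inv b Mu)); exact: inj.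
- by rewrite -rg image_comp.
Qed.

Lemma image_affine_inv M b C : M \in unitmx ->
  affine_map (invmx M) (- (b *m invmx M)) @` (affine_map M b @` C) = C.
Proof.
move=> Mu; rewrite image_comp (_ : _ \o _ = id) ?image_id //.
by apply/funext => p /=; rewrite affine_map_inv.
Qed.

(** An affine map and its inverse transport parametrizations both ways, and
    directions of velocity vectors do not depend on the orientation, so the
    sign of [\det M] is immaterial. *)
Lemma tangent_dir_affine C M b x : M \in unitmx ->
  tangent_dir (affine_map M b @` C) (affine_map M b x) =
    [set v *m M | v in tangent_dir C x].
Proof.
move=> Mu; apply/seteqP; split=> v /=.
  move=> [g [t [k [cg gt ->]]]].
  have Mu' : invmx M \in unitmx by rewrite unitmx_inv.
  have [cg' D] := closed_param_affine (- (b *m invmx M)) Mu' cg.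
  rewrite image_affine_inv // in cg'.
  exists (k *: (derive1 g t *m invmx M)); last by rewrite -scalemxAl mulmxKV.
  exists (affine_map (invmx M) (- (b *m invmx M)) \o g), t, k; split=> //=.
    by rewrite gt affine_map_inv.
  by rewrite D.
move=> [_ [g [t [k [cg gt ->]]]] <-].
have [cg' D] := closed_param_affine b Mu cg.
exists (affine_map M b \o g), t, k; split=> //=; first by rewrite gt.
by rewrite D scalemxAl.
Qed.

Lemma iotaC_affine C M b x : oval C -> C x -> M \in unitmx ->
  iotaC (affine_map M b @` C) (affine_map M b x) = affine_map M b (iotaC C x).
Proof.
move=> oC Cx Mu.
have Ainj := can_inj (affine_map_inv b Mu).
have imK X : [set w *m invmx M | w in [set v *m M | v in X]] = X.
  rewrite image_comp (_ : _ \o _ = id) ?image_id //.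
  by apply/funext => v /=; rewrite mulmxK.
have [Ci ix e] := iotaCP oC Cx.
rewrite /iotaC; case: xgetP =>
  [z _ [[y Cy <-] yx e']|/(_ (affine_map M b (iotaC C x))) []].
  congr affine_map; apply/esym/iotaC_unique => //.
    by apply: contra_neq yx => ->.
  rewrite -[LHS]imK -[RHS]imK -(tangent_dir_affine C b y Mu) e'.
  by rewrite tangent_dir_affine.
split; [by exists (iotaC C x)| |by rewrite !tangent_dir_affine // e].
by apply: contra_neq ix => /Ainj.
Qed.

Lemma affine_line_join M b x y : M \in unitmx -> x != y ->
  affine_line M b (join x y) = join (affine_map M b x) (affine_map M b y).
Proof.
move=> Mu xy; have Ainj := can_inj (affine_map_inv b Mu).
apply: join_unique; first by apply: contra_neq xy => /Ainj.
  by rewrite points_affine_line //; exists x => //; rewrite points_join //= det2B0.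
by rewrite points_affine_line //; exists y => //; rewrite points_join //= det2vv.
Qed.

(** A chord of the image lies on the image of [l] exactly when its preimage is
    the chord of [C] on [l], so the defining property of the reflected line is
    transported together with the opposite points. *)
Lemma reflection_affine C M b l : oval C -> M \in unitmx -> secant C l ->
  affine_reflection (affine_map M b @` C) (affine_line M b l) =
          affine_line M b (affine_reflection C l).
Proof.
move=> oC Mu /(secantE _ oC)[x [y [Cx Cy xy ->]]].
have Ainj := can_inj (affine_map_inv b Mu).
rewrite affine_reflection_join // !affine_line_join ?iotaC_neq //.
rewrite -!iotaC_affine //.
rewrite /affine_reflection; case: xgetP => [m _|/(_ _) h]; last first.
  case: (h (join (iotaC (affine_map M b @` C) (affine_map M b x))
    (iotaC (affine_map M b @` C) (affine_map M b y)))).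
  exists (affine_map M b x), (affine_map M b y); split=> //.
  by apply: contra_neq xy => /Ainj.
move=> [_ [_ [[x' Cx' <-] [y' Cy' <-] n e ->]]].
have xy' : x' != y' by apply: contra_neq n => ->.
move: e; rewrite -!affine_line_join // => e.
(* [affine_line M b] is injective, since its lines are images of lines. *)
have e' : join x y = join x' y'.
  apply: join_unique => //.
  - have : points (affine_line M b (join x' y')) (affine_map M b x').
      by rewrite points_affine_line //; exists x' => //; rewrite points_join //= det2B0.
    by rewrite -e points_affine_line // => -[p + /Ainj <-].
  - have : points (affine_line M b (join x' y')) (affine_map M b y').
      by rewrite points_affine_line //; exists y' => //; rewrite points_join //= det2vv.
    by rewrite -e points_affine_line // => -[p + /Ainj <-].
have [[-> ->]|[-> ->]] := join_inj oC Cx Cy Cx' Cy' xy xy' e'; first by [].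
exact: Defs.joinC.
Qed.

End affine_equivariance.

Theorem theorem2p2 (R : realType) (C : set 'rV[R]_2) (hC : oval C) :
  [/\ open (secant C),
      diffeomorphism (secant C) (secant C) (affine_reflection C),
      (forall l, secant C l ->
         affine_reflection C (affine_reflection C l) = l),
      [set l | secant C l /\ affine_reflection C l = l] =
        [set join x (iotaC C x) | x in C]
    & forall (M : 'M[R]_2) (b : 'rV[R]_2), M \in unitmx ->
        forall l, secant C l ->
          affine_reflection (affine_map M b @` C) (affine_line M b l) =
          affine_line M b (affine_reflection C l)].
Proof.
split.
- exact: secant_open.
- have inv l : l \in secant C -> affine_reflection C (affine_reflection C l) = l.
    by move=> /set_mem; exact: reflectionK.
  exists (affine_reflection C); split=> //.
  + by move=> l; exact: secant_reflection.
  + by move=> l; exact: secant_reflection.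
  + by split; exact: reflection_smooth.
- by move=> l; exact: reflectionK.
- exact: reflection_fixed.
- by move=> M b Mu l; exact: reflection_affine.
Qed.
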